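(* Let Assumptions 1--5 (listed in the context) hold. Then every accumulation point $\bar\mu$ of the sequence $\{\mu^{(k)}\}_{k\in\mathbb N}\subset\mathcal P$ generated by the TR-RB algorithm is an approximate first-order critical point for $\hat{\mathcal J}_h$ (up to the chosen tolerance $\tau_{\mathrm{sub}}$), i.e. it holds $$\|\bar\mu-\mathrm P_{\mathcal P}(\bar\mu-\nabla_\mu\hat{\mathcal J}_h(\bar\mu))\|_2\le\tau_{\mathrm{sub}}.$$
   Context: Setting. Let $P\in\mathbb N$, $\mu_{\mathsf a},\mu_{\mathsf b}\in\mathbb R^P$, $\mathcal P=\{\mu\in\mathbb R^P:\mu_{\mathsf a}\le\mu\le\mu_{\mathsf b}\}$ (componentwise), and $\mathrm P_{\mathcal P}:\mathbb R^P\to\mathcal P$ the componentwise projection (clipping) onto $\mathcal P$. $V$ is a real Hilbert space with norm $\|\cdot\|$, $V_h\subset V$ a finite-dimensional subspace. For each $\mu\in\mathcal P$: $a_\mu$ is a continuous, coercive, symmetric bilinear form on $V$; $l_\mu,j_\mu\in V'$; $k_\mu$ is a continuous symmetric bilinear form on $V$; $\Theta:\mathcal P\to\mathbb R$; $\mathcal J(u,\mu)=\Theta(\mu)+j_\mu(u)+k_\mu(u,u)$. Residuals: $r^{\mathrm{pr}}_\mu(u)[v]=l_\mu(v)-a_\mu(u,v)$, $r^{\mathrm{du}}_\mu(u,p)[v]=j_\mu(v)+2k_\mu(v,u)-a_\mu(v,p)$. Full order model (FOM): $u_{h,\mu}\in V_h$ solves $a_\mu(u_{h,\mu},v_h)=l_\mu(v_h)$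 for all $v_h\in V_h$; $p_{h,\mu}\in V_h$ solves $a_\mu(v_h,p_{h,\mu})=j_\mu(v_h)+2k_\mu(v_h,u_{h,\mu})$ for all $v_h\in V_h$; $\hat{\mathcal J}_h(\mu)=\mathcal J(u_{h,\mu},\mu)$. Reduced basis (RB) model with index $k$: given subspaces $V_r^{\mathrm{pr},k},V_r^{\mathrm{du},k}\subset V_h$, let $u_{r,\mu}\in V_r^{\mathrm{pr},k}$ solve $a_\mu(u_{r,\mu},v)=l_\mu(v)$ for all $v\in V_r^{\mathrm{pr},k}$, let $p_{r,\mu}\in V_r^{\mathrm{du},k}$ solve $a_\mu(q,p_{r,\mu})=j_\mu(q)+2k_\mu(q,u_{r,\mu})$ for all $q\in V_r^{\mathrm{du},k}$, and set $\hat{\mathcal J}_r^{(k)}(\mu)=\mathcal J(u_{r,\mu},\mu)+r^{\mathrm{pr}}_\mu(u_{r,\mu})[p_{r,\mu}]$. Error estimator: $\Delta_{\hat{\mathcal J}_r^{(k)}}(\mu)=\Delta_{\mathrm{pr}}(\mu)\|r^{\mathrm{du}}_\mu(u_{r,\mu},p_{r,\mu})\|+\Delta_{\mathrm{pr}}(\mu)^2\gamma_{k_\mu}$ with $\Delta_{\mathrm{pr}}(\mu)=\underline{a_\mu}^{-1}\|r_\mu^{\mathrm{pr}}(u_{r,\mu})\|$, where residual norms are dual norms in $V_h'$, $\underline{a_\mu}>0$ is the coercivity constant of $a_\mu$ on $V_h$ and $\gamma_{k_\mu}$ the continuity constant of $k_\mu$ on $V_h$. RB spaces: initially $V_r^{\mathrm{pr},0}=\mathrm{span}\{u_{h,\mu^{(0)}}\}$,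 $V_r^{\mathrm{du},0}=\mathrm{span}\{p_{h,\mu^{(0)}}\}$. Updating (enriching) the RB model at $\mu$ means either (a) adding $u_{h,\mu}$ to the primal space and $p_{h,\mu}$ to the dual space, or (b) using a single space for both, obtained from the previous primal space by adding $u_{h,\mu}$ and $p_{h,\mu}$. Trust-Region (TR) sub-problem at iteration $k$ with radius $\delta^{(k)}$: minimize $\hat{\mathcal J}_r^{(k)}(\tilde\mu)$ over $\tilde\mu\in\mathcal P$ subject to $\Delta_{\hat{\mathcal J}_r^{(k)}}(\tilde\mu)/\hat{\mathcal J}_r^{(k)}(\tilde\mu)\le\delta^{(k)}$. It is solved by a projected BFGS iteration: $\mu^{(k,0)}=\mu^{(k)}$, $\mu^{(k,\ell)}(j)=\mathrm P_{\mathcal P}(\mu^{(k,\ell)}+\kappa^jd^{(k,\ell)})$ with $\kappa\in(0,1)$, $d^{(k,0)}=-\nabla_\mu\hat{\mathcal J}_r^{(k)}(\mu^{(k,0)})$, and for $\ell\ge1$ $d^{(k,\ell)}$ the descent direction of the projected BFGS method for box constraints (as in Kelley's book Iterative Methods for Optimization: minus the gradient on the active components, and minus the BFGS inverse-Hessian approximation applied to the gradient on the inactive components). The next inner iterate is $\mu^{(k,\ell+1)}=\mu^{(k,\ell)}(j)$ with the smallest integer $j\ge0$ such that, for a fixed $\kappa_{\mathsf{arm}}\in(0,\tfrac12)$, $$\hat{\mathcal J}_r^{(k)}(\mu^{(k,\ell)}(j))-\hat{\mathcal J}_r^{(k)}(\mu^{(k,\ell)})\le-\frac{\kappa_{\mathsf{arm}}}{\kappa^j}\|\mu^{(k,\ell)}(j)-\mu^{(k,\ell)}\|_2^2\quad\text{and}\quad\frac{\Delta_{\hat{\mathcal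 J}_r^{(k)}}(\mu^{(k,\ell)}(j))}{\hat{\mathcal J}_r^{(k)}(\mu^{(k,\ell)}(j))}\le\delta^{(k)}.$$ The first inner iterate is the approximate generalized Cauchy (AGC) point, $\mu^{(k)}_{\mathrm{AGC}}=\mu^{(k,1)}$. The inner iteration terminates at $\mu^{(k+1)}:=\mu^{(k,L)}$ when either $\|\mu^{(k,\ell)}-\mathrm P_{\mathcal P}(\mu^{(k,\ell)}-\nabla_\mu\hat{\mathcal J}_r^{(k)}(\mu^{(k,\ell)}))\|_2\le\tau_{\mathrm{sub}}$, or $\beta_2\delta^{(k)}\le\Delta_{\hat{\mathcal J}_r^{(k)}}(\mu^{(k,\ell)})/\hat{\mathcal J}_r^{(k)}(\mu^{(k,\ell)})\le\delta^{(k)}$. TR-RB algorithm. Data: initial radius $\delta^{(0)}>0$, $\beta_1,\beta_2\in(0,1)$, $\eta_\varrho\in[\tfrac34,1)$, initial $\mu^{(0)}\in\mathcal P$, tolerances $\tau_{\mathrm{sub}}\le\tau_{\mathrm{FOC}}\ll1$. For $k=0,1,\dots$: 1. Compute $\mu^{(k+1)}$ as solution of the TR sub-problem, terminating the projected BFGS iteration when either $\|\mu^{(k,\ell)}-\mathrm P_{\mathcal P}(\mu^{(k,\ell)}-\nabla_\mu\hat{\mathcal J}_r^{(k)}(\mu^{(k,\ell)}))\|_2\le\tau_{\mathrm{sub}}$ or $\beta_2\delta^{(k)}\le\Delta_{\hat{\mathcal J}_r^{(k)}}(\mu^{(k,\ell)})/\hat{\mathcal J}_r^{(k)}(\mu^{(k,\ell)})\le\delta^{(k)}$.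 2. If $\hat{\mathcal J}_r^{(k)}(\mu^{(k+1)})+\Delta_{\hat{\mathcal J}_r^{(k)}}(\mu^{(k+1)})<\hat{\mathcal J}_r^{(k)}(\mu^{(k)}_{\mathrm{AGC}})$: accept $\mu^{(k+1)}$, update the RB model at $\mu^{(k+1)}$, compute $\varrho^{(k)}=\frac{\hat{\mathcal J}_h(\mu^{(k)})-\hat{\mathcal J}_h(\mu^{(k+1)})}{\hat{\mathcal J}_r^{(k)}(\mu^{(k)})-\hat{\mathcal J}_r^{(k)}(\mu^{(k+1)})}$; set $\delta^{(k+1)}=\beta_1^{-1}\delta^{(k)}$ if $\varrho^{(k)}\ge\eta_\varrho$ and $\delta^{(k+1)}=\delta^{(k)}$ otherwise. 3. Else if $\hat{\mathcal J}_r^{(k)}(\mu^{(k+1)})-\Delta_{\hat{\mathcal J}_r^{(k)}}(\mu^{(k+1)})>\hat{\mathcal J}_r^{(k)}(\mu^{(k)}_{\mathrm{AGC}})$: reject $\mu^{(k+1)}$, shrink the radius by the factor $\beta_1$ and go to step 1 (without increasing $k$). 4. Else: update the RB model at $\mu^{(k+1)}$ and compute $\varrho^{(k)}$. If $\hat{\mathcal J}_r^{(k+1)}(\mu^{(k+1)})\le\hat{\mathcal J}_r^{(k)}(\mu^{(k)}_{\mathrm{AGC}})$, accept $\mu^{(k+1)}$ and set $\delta^{(k+1)}$ as in step 2; otherwise reject $\mu^{(k+1)}$, shrink the radius by the factor $\beta_1$ and go to step 1 (without increasing $k$). 5. If $\|\mu^{(k+1)}-\mathrm P_{\mathcal P}(\mu^{(k+1)}-\nabla_\mu\hat{\mathcal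 J}_h(\mu^{(k+1)}))\|_2\le\tau_{\mathrm{FOC}}$, stop; otherwise increase $k$ by one. Assumptions. Assumption 1 (parameter separability): $a_\mu(u,v)=\sum_{\xi=1}^{\Xi^a}\theta^a_\xi(\mu)a_\xi(u,v)$ with parameter-independent bilinear forms $a_\xi$ and functions $\theta^a_\xi:\mathcal P\to\mathbb R$; analogously for $l_\mu,j_\mu,k_\mu$. Assumption 2: $a_\mu,l_\mu,\mathcal J$ (and hence the coefficient functions) are twice Fréchet differentiable with respect to $\mu$. Assumption 3 (''truth''): $V_h$ is rich enough that the discretization errors between the exact primal and dual solutions and their parameter sensitivities on $V$ and those on $V_h$ are considered negligible. Assumption 4: $\mathcal J(u,\mu)>0$ for all $u\in V$, $\mu\in\mathcal P$. Assumption 5: for each $k\ge0$ there is a radius $\tilde\delta^{(k)}>\tau_{\mathrm{mac}}=2.22\cdot10^{-16}$ for which a solution $\mu^{(k+1)}$ of the TR sub-problem satisfies the sufficient decrease condition $\hat{\mathcal J}_r^{(k+1)}(\mu^{(k+1)})\le\hat{\mathcal J}_r^{(k)}(\mu^{(k)}_{\mathrm{AGC}})$. *)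

(* Defs.v *)
From HB Require Import structures.
From mathcomp Require Import all_boot all_order all_algebra.
From mathcomp Require Import all_classical all_reals all_analysis.

Set Implicit Arguments.
Unset Strict Implicit.
Unset Printing Implicit Defensive.

Import Order.TTheory GRing.Theory Num.Theory.
Import numFieldNormedType.Exports.

Local Open Scope classical_set_scope.
Local Open Scope ring_scope.

Section euclidean_space.
Context {R : realType} {P : nat}.
Implicit Types (x y g lo up : 'rV[R]_P) (f : 'rV[R]_P -> R).

(* The library norm of 'rV[R]_P is the maximum norm. *)
Definition norm2 x : R := Num.sqrt (\sum_i x 0 i ^+ 2).

Definition box lo up : set 'rV[R]_P :=
  [set x | forall i, lo 0 i <= x 0 i <= up 0 i].

Definition clip lo up x : 'rV[R]_P :=
  \row_i Num.max (lo 0 i) (Num.min (x 0 i) (up 0 i)).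

Definition grad f x : 'rV[R]_P := \row_i 'D_(delta_mx 0 i) f x.

(* The derivative of f is identified with its gradient.  At a boundary point of
   the parameter box, differentiability is that of a function on an open
   neighbourhood of the point. *)
Definition twice_differentiable f x : Prop :=
  (\forall y \near x, differentiable f y) /\ differentiable (grad f) x.

Definition criticality lo up f x : R := norm2 (x - clip lo up (x - grad f x)).

End euclidean_space.

Section projected_BFGS.
Context {R : realType} {P : nat}.
Variables (lo up : 'rV[R]_P).
Implicit Types (x g : 'rV[R]_P) (H : 'M[R]_P) (eps : R).

Definition active eps x (i : 'I_P) : bool :=
  (x 0 i - lo 0 i <= eps) || (up 0 i - x 0 i <= eps).

Definition proj_active eps x : 'M[R]_P := diag_mx (\row_i (active eps x i)%:R).

Definition proj_inactive eps x : 'M[R]_P := 1%:M - proj_active eps x.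

(* Vectors are rows, so symmetric matrices act from the right. *)
Definition bfgs_direction eps x g H : 'rV[R]_P :=
  - (g *m proj_active eps x
     + g *m proj_inactive eps x *m H *m proj_inactive eps x).

(* The inverse BFGS update on the components that are inactive at the new point
   x', reset to the identity when the curvature condition fails (Kelley,
   Iterative Methods for Optimization, Section 5.5.3). *)
Definition bfgs_update eps x g x' g' H : 'M[R]_P :=
  let PI := proj_inactive eps x' in
  let s := (x' - x) *m PI in
  let y := (g' - g) *m PI in
  let c := (y *m s^T) 0 0 in
  if 0 < c then
    proj_active eps x'
    + (1%:M - c^-1 *: (s^T *m y)) *m (PI *m H *m PI)
        *m (1%:M - c^-1 *: (y^T *m s))
    + c^-1 *: (s^T *m s)
  else 1%:M.

(* Below, f is the model functional and q is the relative error estimator, so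
   that the trust region is the set of points where q <= delta. *)
Definition line_search (f q : 'rV[R]_P -> R) (kappa kappa_arm delta : R)
    (x d x' : 'rV[R]_P) : Prop :=
  let trial (j : nat) := clip lo up (x + kappa ^+ j *: d) in
  let admissible (j : nat) :=
    f (trial j) - f x <= - (kappa_arm / kappa ^+ j) * norm2 (trial j - x) ^+ 2
    /\ q (trial j) <= delta in
  exists j : nat,
    [/\ admissible j, (forall i : nat, (i < j)%N -> ~ admissible i)
      & x' = trial j].

Definition inner_stop (f q : 'rV[R]_P -> R) (tau_sub beta2 delta : R)
    (x : 'rV[R]_P) : Prop :=
  criticality lo up f x <= tau_sub \/ beta2 * delta <= q x <= delta.

(* L is the first index at which the termination criterion holds.  The iterate
   m 1, the AGC point, is computed even if L = 0.  The tolerances eps define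
   the active sets; the values of m beyond maxn L 1 are irrelevant. *)
Definition inner_iteration (f q : 'rV[R]_P -> R)
    (kappa kappa_arm tau_sub beta2 delta : R)
    (mu : 'rV[R]_P) (m : nat -> 'rV[R]_P) (L : nat) : Prop :=
  exists (eps : nat -> R) (H : nat -> 'M[R]_P),
    let g l := grad f (m l) in
    let d l := if l is 0%N then - g 0%N
               else bfgs_direction (eps l) (m l) (g l) (H l) in
    [/\ forall l, 0 <= eps l,
        H 0%N = 1%:M
        /\ (forall l, H l.+1 = bfgs_update (eps l.+1) (m l) (g l)
                                 (m l.+1) (g l.+1) (H l)),
        m 0%N = mu,
        (forall l, (l < maxn L 1)%N ->
           line_search f q kappa kappa_arm delta (m l) (d l) (m l.+1))
      & inner_stop f q tau_sub beta2 delta (m L)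
        /\ (forall l, (l < L)%N ->
              ~ inner_stop f q tau_sub beta2 delta (m l))].

End projected_BFGS.

Section forms.
Context {R : realType} {V : completeNormedModType R}.
Implicit Types (b : V -> V -> R) (f : V -> R) (W : set V).

(* Together with completeness of V, this makes V a real Hilbert space. *)
Definition inner_product (ip : {dot V for idfun}) : Prop :=
  forall v : V, `|v| ^+ 2 = ip v v.

Definition finite_dim_subspace W : Prop :=
  exists (n : nat) (e : 'I_n -> V),
    W = [set \sum_i c i *: e i | c in [set: 'I_n -> R]].

Definition bounded_functional f : Prop :=
  exists C : R, forall v, `|f v| <= C * `|v|.

Definition bounded_form b : Prop :=
  exists C : R, forall u v, `|b u v| <= C * `|u| * `|v|.

Definition symmetric_form b : Prop := forall u v, b u v = b v u.

Definition coercive_form b : Prop :=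
  exists2 c : R, 0 < c & forall v, c * `|v| ^+ 2 <= b v v.

Definition dual_norm W f : R :=
  sup [set `|f v| | v in [set v | W v /\ `|v| <= 1]].

Definition coercivity_constant W b : R :=
  inf [set b v v / `|v| ^+ 2 | v in [set v | W v /\ v != 0]].

Definition continuity_constant W b : R :=
  sup [set r | exists u v, [/\ W u, W v, `|u| <= 1, `|v| <= 1
                             & r = `|b u v|]].

Definition galerkin W b f : V :=
  xget 0 [set u | W u /\ forall v, W v -> b u v = f v].

Definition line_of (v : V) : set V := [set c *: v | c in [set: R]].

Definition add_snapshot W (v : V) : set V :=
  [set w + z | w in W & z in line_of v].

End forms.

(* The parameter-dependent data are extended from the parameter box to 'rV_P. *)
Record problem (R : realType) (V : completeNormedModType R) (P : nat) :=
  Problem {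
    mu_a : 'rV[R]_P;
    mu_b : 'rV[R]_P;
    Vh : set V;
    a_ : 'rV[R]_P -> {biscalar V};
    l_ : 'rV[R]_P -> {scalar V};
    j_ : 'rV[R]_P -> {scalar V};
    k_ : 'rV[R]_P -> {biscalar V};
    Theta : 'rV[R]_P -> R }.

Record decomposition (R : realType) (V : completeNormedModType R) (P : nat) :=
  Decomposition {
    Xi_a : nat;
    theta_a : 'I_Xi_a -> 'rV[R]_P -> R;
    comp_a : 'I_Xi_a -> {biscalar V};
    Xi_l : nat;
    theta_l : 'I_Xi_l -> 'rV[R]_P -> R;
    comp_l : 'I_Xi_l -> {scalar V};
    Xi_j : nat;
    theta_j : 'I_Xi_j -> 'rV[R]_P -> R;
    comp_j : 'I_Xi_j -> {scalar V};
    Xi_k : nat;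
    theta_k : 'I_Xi_k -> 'rV[R]_P -> R;
    comp_k : 'I_Xi_k -> {biscalar V} }.

Record rb_spaces (R : realType) (V : completeNormedModType R) :=
  RBSpaces { Vpr : set V; Vdu : set V }.

Section models.
Context {R : realType} {V : completeNormedModType R} {P : nat}.
Variable pb : problem V P.
Implicit Types (mu : 'rV[R]_P) (u p v : V) (S : rb_spaces V).

Definition param_set : set 'rV[R]_P := box (mu_a pb) (mu_b pb).

Definition well_posed : Prop :=
  finite_dim_subspace (Vh pb)
  /\ forall mu, param_set mu ->
     [/\ [/\ bounded_form (a_ pb mu), coercive_form (a_ pb mu)
            & symmetric_form (a_ pb mu)],
         bounded_functional (l_ pb mu),
         bounded_functional (j_ pb mu)
       & bounded_form (k_ pb mu) /\ symmetric_form (k_ pb mu)].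

Definition cost u mu : R := Theta pb mu + j_ pb mu u + k_ pb mu u u.

Definition res_pr mu u v : R := l_ pb mu v - a_ pb mu u v.

Definition dual_rhs mu u v : R := j_ pb mu v + 2 * k_ pb mu v u.

Definition res_du mu u p v : R := dual_rhs mu u v - a_ pb mu v p.

Definition primal (W : set V) mu : V := galerkin W (a_ pb mu) (l_ pb mu).

Definition dual (W : set V) mu u : V :=
  galerkin W (fun p v => a_ pb mu v p) (dual_rhs mu u).

Definition u_exact mu : V := primal setT mu.
Definition p_exact mu : V := dual setT mu (u_exact mu).

Definition u_h mu : V := primal (Vh pb) mu.
Definition p_h mu : V := dual (Vh pb) mu (u_h mu).
Definition Jh mu : R := cost (u_h mu) mu.

Definition u_r S mu : V := primal (Vpr S) mu.
Definition p_r S mu : V := dual (Vdu S) mu (u_r S mu).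
Definition Jr S mu : R := cost (u_r S mu) mu + res_pr mu (u_r S mu) (p_r S mu).

Definition Delta_pr S mu : R :=
  (coercivity_constant (Vh pb) (a_ pb mu))^-1
  * dual_norm (Vh pb) (res_pr mu (u_r S mu)).

Definition Delta_J S mu : R :=
  Delta_pr S mu * dual_norm (Vh pb) (res_du mu (u_r S mu) (p_r S mu))
  + Delta_pr S mu ^+ 2 * continuity_constant (Vh pb) (k_ pb mu).

Definition rel_error S mu : R := Delta_J S mu / Jr S mu.

Definition rb_init mu : rb_spaces V :=
  RBSpaces (line_of (u_h mu)) (line_of (p_h mu)).

(* Separate spaces, or a single space built from the primal one. *)
Definition rb_update S mu (S' : rb_spaces V) : Prop :=
  S' = RBSpaces (add_snapshot (Vpr S) (u_h mu)) (add_snapshot (Vdu S) (p_h mu))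
  \/ (let W := add_snapshot (add_snapshot (Vpr S) (u_h mu)) (p_h mu) in
      S' = RBSpaces W W).

Definition separable (dec : decomposition V P) : Prop :=
  [/\ forall mu u v, a_ pb mu u v
        = \sum_(q < Xi_a dec) theta_a q mu * comp_a q u v,
      forall mu v, l_ pb mu v
        = \sum_(q < Xi_l dec) theta_l q mu * comp_l q v,
      forall mu v, j_ pb mu v
        = \sum_(q < Xi_j dec) theta_j q mu * comp_j q v
    & forall mu u v, k_ pb mu u v
        = \sum_(q < Xi_k dec) theta_k q mu * comp_k q u v].

Definition smooth_data (dec : decomposition V P) : Prop :=
  forall mu, param_set mu ->
  [/\ forall u v, twice_differentiable (fun x => a_ pb x u v) mu,
      forall v, twice_differentiable (fun x => l_ pb x v) mu,
      forall u, twice_differentiable (cost u) mu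
    & [/\ forall q : 'I_(Xi_a dec), twice_differentiable (theta_a q) mu,
          forall q : 'I_(Xi_l dec), twice_differentiable (theta_l q) mu,
          forall q : 'I_(Xi_j dec), twice_differentiable (theta_j q) mu
        & forall q : 'I_(Xi_k dec), twice_differentiable (theta_k q) mu]].

(* The discretization errors of the states and of their sensitivities are at
   most eps_h, the level that is regarded as negligible. *)
Definition truth (eps_h : R) : Prop :=
  forall mu, param_set mu ->
  [/\ `|u_exact mu - u_h mu| <= eps_h,
      `|p_exact mu - p_h mu| <= eps_h,
      forall i : 'I_P,
        `|'D_(delta_mx 0 i) u_exact mu - 'D_(delta_mx 0 i) u_h mu| <= eps_h
    & forall i : 'I_P,
        `|'D_(delta_mx 0 i) p_exact mu - 'D_(delta_mx 0 i) p_h mu| <= eps_h].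

Definition positive_cost : Prop :=
  forall u mu, param_set mu -> 0 < cost u mu.

End models.

Record tr_parameters (R : realType) (P : nat) := TRParameters {
  mu_init : 'rV[R]_P;
  delta_init : R;
  kappa : R;
  kappa_arm : R;
  beta1 : R;
  beta2 : R;
  eta_rho : R;
  tau_sub : R;
  tau_foc : R }.

Record tr_state (R : realType) (V : completeNormedModType R) (P : nat) :=
  TRState { st_mu : 'rV[R]_P; st_delta : R; st_rb : rb_spaces V }.

Section algorithm.
Context {R : realType} {V : completeNormedModType R} {P : nat}.
Variables (pb : problem V P) (par : tr_parameters R P).
Implicit Types (S : rb_spaces V) (mu : 'rV[R]_P) (delta : R).

Definition admissible_parameters : Prop :=
  [/\ param_set pb (mu_init par) /\ 0 < delta_init par,
      0 < kappa par < 1 /\ 0 < kappa_arm par < 2^-1,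
      0 < beta1 par < 1 /\ 0 < beta2 par < 1,
      3 / 4 <= eta_rho par < 1
    & 0 <= tau_sub par /\ tau_sub par <= tau_foc par < 1].

Definition tr_subproblem S mu delta (m : nat -> 'rV[R]_P) (L : nat) : Prop :=
  inner_iteration (mu_a pb) (mu_b pb) (Jr pb S) (rel_error pb S)
    (kappa par) (kappa_arm par) (tau_sub par) (beta2 par) delta mu m L.

(* agc and mu' are the first and the last iterate of the inner iteration. *)
Definition tr_solve S mu delta agc mu' : Prop :=
  exists (m : nat -> 'rV[R]_P) (L : nat),
    [/\ tr_subproblem S mu delta m L, agc = m 1%N & mu' = m L].

Definition rho S mu mu' : R :=
  (Jh pb mu - Jh pb mu') / (Jr pb S mu - Jr pb S mu').

Definition next_delta S mu delta mu' : R :=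
  if eta_rho par <= rho S mu mu' then (beta1 par)^-1 * delta else delta.

Definition surely_decreasing S agc mu' : Prop :=
  Jr pb S mu' + Delta_J pb S mu' < Jr pb S agc.

Definition surely_increasing S agc mu' : Prop :=
  Jr pb S mu' - Delta_J pb S mu' > Jr pb S agc.

(* One outer iteration, from the state with index k to that with index k+1.
   A rejection shrinks the radius and solves the sub-problem again; as k does
   not increase, this is done with the same model k. *)
Inductive tr_step : tr_state V P -> tr_state V P -> Prop :=
| tr_accept mu delta S agc mu' S' :
    tr_solve S mu delta agc mu' ->
    surely_decreasing S agc mu' ->
    rb_update pb S mu' S' ->
    tr_step (TRState mu delta S) (TRState mu' (next_delta S mu delta mu') S')
| tr_reject mu delta S agc mu' st :
    tr_solve S mu delta agc mu' ->
    ~ surely_decreasing S agc mu' ->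
    surely_increasing S agc mu' ->
    tr_step (TRState mu (beta1 par * delta) S) st ->
    tr_step (TRState mu delta S) st
| tr_accept_updated mu delta S agc mu' S' :
    tr_solve S mu delta agc mu' ->
    ~ surely_decreasing S agc mu' ->
    ~ surely_increasing S agc mu' ->
    rb_update pb S mu' S' ->
    Jr pb S' mu' <= Jr pb S agc ->
    tr_step (TRState mu delta S) (TRState mu' (next_delta S mu delta mu') S')
| tr_reject_updated mu delta S agc mu' S' st :
    tr_solve S mu delta agc mu' ->
    ~ surely_decreasing S agc mu' ->
    ~ surely_increasing S agc mu' ->
    rb_update pb S mu' S' ->
    ~ Jr pb S' mu' <= Jr pb S agc ->
    tr_step (TRState mu (beta1 par * delta) S) st ->
    tr_step (TRState mu delta S) st.

Definition foc_stop mu : Prop :=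
  criticality (mu_a pb) (mu_b pb) (Jh pb) mu <= tau_foc par.

(* The algorithm stops when foc_stop holds.  The infinite sequences it generates
   are therefore those with foc_test = true; foc_test = false gives those of the
   idealized algorithm that ignores this stopping criterion. *)
Definition tr_rb_sequence (foc_test : bool) (st : nat -> tr_state V P) : Prop :=
  st 0%N = TRState (mu_init par) (delta_init par) (rb_init pb (mu_init par))
  /\ forall k : nat, tr_step (st k) (st k.+1)
                     /\ (foc_test -> ~ foc_stop (st_mu (st k.+1))).

Definition tau_mac : R := 222 / 10 ^+ 18.

(* For each k, the iterate k+1 is also a solution of the sub-problem for some
   radius above tau_mac, with sufficient decrease. *)
Definition sufficient_decrease (st : nat -> tr_state V P) : Prop :=
  forall k : nat, exists delta agc,
    [/\ tau_mac < delta,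
        tr_solve (st_rb (st k)) (st_mu (st k)) delta agc (st_mu (st k.+1))
      & Jr pb (st_rb (st k.+1)) (st_mu (st k.+1)) <= Jr pb (st_rb (st k)) agc].

End algorithm.

(* Main.v *)
Require Import Defs.
From HB Require Import structures.
From mathcomp Require Import all_boot all_order all_algebra.
From mathcomp Require Import all_classical all_reals all_analysis.
From mathcomp Require Import ring lra.

(* Error estimates that are quadratic in the distance to mu, uniformly in the
   reduced spaces containing the snapshots of mu, replace any derivative of the
   reduced solutions.  With the Lagrangian
   L(u, p, x) = cost u x + res_pr x u p, and u, p the solutions at mu, all terms
   of Jr S x - L(u, p, x) that are linear in the errors of the solutions at x are
   residuals of (u, p), which vanish at mu; as the solutions are Lipschitz, this
   difference and Delta_J S x are O(|x - mu|^2).  The full order model is the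
   case where both spaces are Vh, so the gradients of Jr S and Jh agree at mu.
   If an accumulation point were not critical, then near it, for the radii above
   tau_mac provided by Assumption 5, the line search of the AGC point would take
   steps bounded away from 0, and Jh would infinitely often drop by a fixed
   amount, although it is positive and nonincreasing along the iterates.  Hence
   the criticality at an accumulation point is even 0. *)

Set Implicit Arguments.
Unset Strict Implicit.
Unset Printing Implicit Defensive.

Import Order.TTheory GRing.Theory Num.Theory.
Import numFieldNormedType.Exports.

Local Open Scope classical_set_scope.
Local Open Scope ring_scope.

(** * Galerkin problems on finite-dimensional subspaces *)

(** The reduced spaces change with the iteration and no compactness controls them, so all constants
    and radii must depend on the accumulation point alone. They therefore come from [Vh], where
    coercivity bounds every Galerkin solution, whatever the subspace. A second obstacle is that
    [well_posed] speaks of the parameter box only, while gradients at a boundary point look at a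
    whole neighbourhood. Separability and finite dimension close this gap: the component forms are
    bounded on [Vh], so the forms are Lipschitz near each point of the box and coercivity survives
    in a ball. Symmetry of [k_] does not carry over; it is used at the base point [mu] alone. In the
    final argument the outer iteration contributes that the spaces contain the snapshots of the
    current iterate. The model is then exact there, and the comparison with the AGC value in
    Assumption 5 becomes monotonicity of the full order cost. As Assumption 5 supplies a radius
    above one fixed positive number for every [k], shrinking of the radii of the algorithm does no
    harm. *)

Section finite_dimensional_forms.
Context {R : realType} {V : completeNormedModType R}.
Implicit Types (W : set V) (b : V -> V -> R) (f : V -> R).

Definition bilinear_form b : Prop :=
  (forall v, scalar (b^~ v)) /\ (forall u, scalar (b u)).

(** Weaker than coercivity, so that it also covers the auxiliary form [q] of [frame_expansion]. *)
Definition definite_on W b : Prop := forall v, W v -> b v v = 0 -> v = 0.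

Lemma scalarB f u v : scalar f -> f (u - v) = f u - f v.
Proof.
by move=> fl; rewrite addrC -scaleN1r fl mulN1r addrC.
Qed.

Lemma scalar0 f : scalar f -> f 0 = 0.
Proof. by move=> fl; rewrite -(subrr 0) scalarB// subrr. Qed.

Lemma scalarD f u v : scalar f -> f (u + v) = f u + f v.
Proof. by move=> fl; have := fl 1 u v; rewrite scale1r mul1r. Qed.

Lemma scalarZ f a u : scalar f -> f (a *: u) = a * f u.
Proof. by move=> fl; have := fl a u 0; rewrite scalar0// !addr0. Qed.

Lemma scalar_sum n f (c : 'I_n -> R) (e : 'I_n -> V) :
  scalar f -> f (\sum_i c i *: e i) = \sum_i c i * f (e i).
Proof.
move=> fl.
apply: (big_ind2 (fun v r => f v = r)) => [|x _ y _ <- <-|i _].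
- exact: scalar0.
- exact: scalarD.
- exact: scalarZ.
Qed.

Lemma finite_dim_subspace0 W : finite_dim_subspace W -> W 0.
Proof.
case=> n [e ->]; exists (fun=> 0) => //=.
by rewrite big1// => i _; rewrite scale0r.
Qed.

Lemma finite_dim_subspaceP W a u v :
  finite_dim_subspace W -> W u -> W v -> W (a *: u + v).
Proof.
case=> n [e ->] [c _ <-] [d _ <-]; exists (fun i => a * c i + d i) => //=.
rewrite scaler_sumr -big_split/=; apply: eq_bigr => i _.
by rewrite scalerDl scalerA.
Qed.

Lemma finite_dim_subspaceB W u v :
  finite_dim_subspace W -> W u -> W v -> W (u - v).
Proof.
move=> Wfd Wu Wv.
by have := finite_dim_subspaceP (-1) Wfd Wv Wu; rewrite scaleN1r addrC.
Qed.

Lemma finite_dim_line (v : V) : finite_dim_subspace (line_of v).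
Proof.
exists 1%N, (fun=> v); apply/seteqP; split=> [_ [c _ <-]|_ [c _ <-]].
  by exists (fun=> c); rewrite //= big_ord1.
by rewrite big_ord1; exists (c ord0).
Qed.

Lemma finite_dim_add_snapshot W v :
  finite_dim_subspace W -> finite_dim_subspace (add_snapshot W v).
Proof.
case=> n [e ->].
exists n.+1, (fun i => if unlift ord0 i is Some j then e j else v).
apply/seteqP; split=> [_ [_ [c _ <-]] [_ [a _ <-] <-]|_ [c _ <-]].
  exists (fun i => if unlift ord0 i is Some j then c j else a) => //=.
  rewrite big_ord_recl unlift_none addrC; congr (_ + _).
  by apply: eq_bigr => i _; rewrite liftK.
exists (\sum_i c (lift ord0 i) *: e i); first by exists (c \o lift ord0).
exists (c ord0 *: v); first by exists (c ord0).
rewrite big_ord_recl unlift_none addrC; congr (_ + _).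
by apply: eq_bigr => i _; rewrite liftK.
Qed.

Lemma sub_add_snapshot W v : W `<=` add_snapshot W v.
Proof.
move=> w Ww; exists w => //; exists 0; last by rewrite addr0.
by exists 0; rewrite ?scale0r.
Qed.

Lemma add_snapshot_mem W v : W 0 -> add_snapshot W v v.
Proof.
move=> W0; exists 0 => //; exists v; last by rewrite add0r.
by exists 1; rewrite ?scale1r.
Qed.

Lemma add_snapshot_sub W X v : finite_dim_subspace X ->
  W `<=` X -> X v -> add_snapshot W v `<=` X.
Proof.
move=> Xfd WX Xv _ [w Ww [_ [c _ <-] <-]].
by rewrite addrC; apply: finite_dim_subspaceP => //; exact: WX.
Qed.

(* The load vector lies in the row space of the Gram matrix, because by
   definiteness the cokernel of that matrix represents the vector 0. *)
Lemma galerkin_exists W b f : finite_dim_subspace W -> bilinear_form b ->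
  scalar f -> definite_on W b -> exists u, W u /\ forall v, W v -> b u v = f v.
Proof.
move=> [n [e ->]] [bl br] fl bdef.
pose A := \matrix_(i < n, j < n) b (e i) (e j).
pose F := \row_(j < n) f (e j).
have : (F <= A)%MS.
  rewrite submxE; apply/eqP/rowP => k; rewrite [RHS]mxE.
  pose x j := cokermx A j k; pose w := \sum_j x j *: e j.
  have bw i : b (e i) w = 0.
    rewrite scalar_sum//.
    have /matrixP/(_ i k) : A *m cokermx A = 0 by exact: mulmx_coker.
    rewrite !mxE => {2}<-; apply: eq_bigr => j _.
    by rewrite mxE mulrC.
  have w0 : w = 0.
    apply: bdef; first by exists x.
    rewrite {1}/w (scalar_sum _ _ (bl w)) big1// => i _.
    by rewrite bw mulr0.
  have : f w = 0.
    by rewrite w0 scalar0.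
  rewrite scalar_sum// => <-; rewrite mxE; apply: eq_bigr => j _.
  by rewrite mxE mulrC.
move=> /submxP[D FDA].
exists (\sum_i D 0 i *: e i); split; first by exists (D 0).
move=> _ [c _ <-]; rewrite (scalar_sum _ _ (br _)) scalar_sum//.
apply: eq_bigr => j _; congr (_ * _).
rewrite (scalar_sum _ _ (bl _)).
move/matrixP: FDA => /(_ 0 j); rewrite !mxE => ->; apply: eq_bigr => i _.
by rewrite mxE.
Qed.

Lemma galerkinP W b f : finite_dim_subspace W -> bilinear_form b ->
  scalar f -> definite_on W b ->
  W (galerkin W b f) /\ forall v, W v -> b (galerkin W b f) v = f v.
Proof.
move=> Wfd bb fl bdef.
exact: (@xgetPex _ 0 [set u | W u /\ forall v, W v -> b u v = f v])
  (galerkin_exists Wfd bb fl bdef).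
Qed.

Lemma galerkin_unique W b f u : finite_dim_subspace W -> bilinear_form b ->
  scalar f -> definite_on W b -> W u -> (forall v, W v -> b u v = f v) ->
  galerkin W b f = u.
Proof.
move=> Wfd bb fl bdef Wu bu.
have [Wg bg] := galerkinP Wfd bb fl bdef.
have Wd := finite_dim_subspaceB Wfd Wg Wu.
apply/eqP; rewrite -subr_eq0; apply/eqP/bdef => //.
by rewrite (scalarB _ _ (bb.1 _)) bg// bu// subrr.
Qed.

(* With S u := \sum_i b (e i) u *: e i, which is invertible on W, the frame
   expansion u = \sum_i b (w i) u *: e i has w i := S^-1 (e i). *)
Lemma frame_expansion W b : finite_dim_subspace W -> bilinear_form b ->
  Defs.symmetric_form b -> definite_on W b ->
  exists n (e w : 'I_n -> V), (forall i, W (e i)) /\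
    forall u, W u -> u = \sum_i b (w i) u *: e i.
Proof.
move=> Wfd bb bsym bdef; case: (Wfd) => n [e eW].
have We i : W (e i).
  rewrite eW; exists (fun j => (j == i)%:R) => //=.
  rewrite (bigD1 i)//= eqxx scale1r big1 ?addr0// => j /negPf ->.
  by rewrite scale0r.
pose q u v := \sum_i b (e i) u * b (e i) v.
have qb : bilinear_form q.
  split=> x a y z; rewrite /q mulr_sumr -big_split/=; apply: eq_bigr => i _;
    rewrite bb.2; lra.
have qdef : definite_on W q.
  move=> v Wv /eqP; rewrite psumr_eq0 => [/allP q0|i _]; last first.
    by rewrite -expr2 sqr_ge0.
  have be i : b (e i) v = 0.
    have := q0 i; rewrite mem_index_enum => /(_ isT).
    by rewrite -expr2 sqrf_eq0 => /eqP.
  apply: bdef => //; move: (Wv); rewrite eW => -[c _ vE].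
  by rewrite -{1}vE (scalar_sum _ _ (bb.1 _)) big1// => i _; rewrite be mulr0.
have /(_ _)/cid-/all_sig[w wP] : forall i : 'I_n,
    exists u, W u /\ forall v, W v -> q u v = b (e i) v.
  by move=> i; apply: galerkin_exists => //; exact: bb.2.
exists n, e, w; split=> // u Wu.
have [z [Wz zP]] : exists z, W z /\ forall v, W v -> q z v = b u v.
  by apply: galerkin_exists => //; exact: bb.2.
have uE : u = \sum_i b (e i) z *: e i.
  apply/eqP; rewrite -subr_eq0; apply/eqP; set y := \sum_i _ *: _.
  have Wy : W y by rewrite eW; exists (fun i => b (e i) z).
  have Wd := finite_dim_subspaceB Wfd Wu Wy.
  apply: bdef => //; set d := u - y in Wd *.
  rewrite {1}/d (scalarB _ _ (bb.1 _)) -zP// (scalar_sum _ _ (bb.1 _)).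
  by rewrite /q subrr.
rewrite {1}uE; apply: eq_bigr => i _; congr (_ *: _).
have [Wwi wiP] := wP i.
rewrite -wiP// bsym -zP//.
by apply: eq_bigr => j _; rewrite mulrC.
Qed.

(** The coordinates [b (w i)] of the frame expansion are bounded functionals because [b] is bounded;
    expanding both arguments leaves finitely many values of [g]. *)
Lemma finite_dim_form_bounded W b g : finite_dim_subspace W ->
  bilinear_form b -> Defs.symmetric_form b -> definite_on W b -> bounded_form b ->
  bilinear_form g ->
  exists C, forall u v, W u -> W v -> `|g u v| <= C * `|u| * `|v|.
Proof.
move=> Wfd bb bsym bdef [B bB] gb.
have [n [e [w [We exp]]]] := frame_expansion Wfd bb bsym bdef.
exists (\sum_i \sum_j (`|B| * `|w i|) * (`|B| * `|w j|) * `|g (e i) (e j)|).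
move=> u v Wu Wv.
rewrite {1}(exp u)// (scalar_sum _ _ (gb.1 _)) -mulrA mulr_suml.
apply: (le_trans (ler_norm_sum _ _ _)); apply: ler_sum => i _.
rewrite {1}(exp v)// (scalar_sum _ _ (gb.2 _)) mulr_suml mulr_sumr.
apply: (le_trans (ler_norm_sum _ _ _)); apply: ler_sum => j _.
rewrite !normrM.
have bw k x : `|b (w k) x| <= `|B| * `|w k| * `|x|.
  apply: (le_trans (bB _ _)); rewrite ler_wpM2r// ler_wpM2r//.
  exact: ler_norm.
have h := ler_pM (normr_ge0 _) (normr_ge0 _) (bw i u) (bw j v).
rewrite mulrA; apply: (le_trans (ler_wpM2r (normr_ge0 _) h)).
by rewrite le_eqVlt; apply/orP; left; apply/eqP; ring.
Qed.

(** Riesz representation: the representing vector is the solution of a Galerkin problem. *)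
Lemma finite_dim_functional_bounded W b f : finite_dim_subspace W ->
  bilinear_form b -> definite_on W b -> bounded_form b -> scalar f ->
  exists C, forall v, W v -> `|f v| <= C * `|v|.
Proof.
move=> Wfd bb bdef [B bB] fl.
have [w [Ww wP]] := galerkin_exists Wfd bb fl bdef.
by exists (B * `|w|) => v Wv; rewrite -wP.
Qed.

End finite_dimensional_forms.

(** * Families of parameter functions with uniform C1 bounds *)

Section coordinates.
Context {R : realType} {P : nat}.
Implicit Types (x y g u v : 'rV[R]_P) (f : 'rV[R]_P -> R).

Definition edot g v : R := \sum_i g 0 i * v 0 i.

Lemma ler_coord_norm x i : `|x 0 i| <= `|x|.
Proof.
rewrite [leRHS]mx_normrE.
exact: (le_bigmax _ (fun ij : 'I_1 * 'I_P => `|x ij.1 ij.2|) (0, i)).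
Qed.

Lemma norm_le_coord x e : 0 <= e -> (forall i, `|x 0 i| <= e) -> `|x| <= e.
Proof.
move=> e0 xe; rewrite [leLHS]mx_normrE.
by apply: bigmax_le => // -[j i] _ /=; rewrite ord1.
Qed.

Lemma edot_norm g v : `|edot g v| <= P%:R * `|g| * `|v|.
Proof.
apply: (le_trans (ler_norm_sum _ _ _)).
rewrite (@le_trans _ _ (\sum_(i < P) `|g| * `|v|))//.
  by apply: ler_sum => i _; rewrite normrM ler_pM// ler_coord_norm.
by rewrite sumr_const card_ord -mulrA mulr_natl.
Qed.

Lemma edotBl g h v : edot (g - h) v = edot g v - edot h v.
Proof. by rewrite /edot -sumrB; apply: eq_bigr => i _; rewrite !mxE mulrBl. Qed.

Lemma edotDl g h v : edot (g + h) v = edot g v + edot h v.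
Proof.
by rewrite /edot -big_split; apply: eq_bigr => i _; rewrite !mxE mulrDl.
Qed.

Lemma edotDr g u v : edot g (u + v) = edot g u + edot g v.
Proof.
by rewrite /edot -big_split; apply: eq_bigr => i _; rewrite !mxE mulrDr.
Qed.

Lemma edotZl a g v : edot (a *: g) v = a * edot g v.
Proof. by rewrite /edot mulr_sumr; apply: eq_bigr => i _; rewrite !mxE mulrA. Qed.

Lemma edotZr a g v : edot g (a *: v) = a * edot g v.
Proof.
by rewrite /edot mulr_sumr; apply: eq_bigr => i _; rewrite !mxE mulrCA.
Qed.

Lemma edot_delta g i : edot g (delta_mx 0 i) = g 0 i.
Proof.
rewrite /edot (bigD1 i)//= big1 ?addr0 => [|j /negPf ji]; rewrite !mxE ?eqxx.
  by rewrite mulr1.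
by rewrite ji mulr0.
Qed.

Lemma diff_edot f x v : differentiable f x -> 'd f x v = edot (grad f x) v.
Proof.
move=> df; rewrite {1}(row_sum_delta v) linear_sum; apply: eq_bigr => i _.
by rewrite linearZ /= !mxE deriveE// mulrC.
Qed.

Lemma is_derive_line f y v s : differentiable f (y + s *: v) ->
  is_derive s (1 : R) (fun t => f (y + t *: v)) (edot (grad f (y + s *: v)) v).
Proof.
move=> df.
have E : (fun h : R => h^-1 *: (((fun t => f (y + t *: v)) \o shift s) (h *: 1)
    - f (y + s *: v)))
  = (fun h => h^-1 *: ((f \o shift (y + s *: v)) (h *: v) - f (y + s *: v))).
  apply/funext => h /=; congr (_ *: (f _ - _)).
  by rewrite addrCA -scalerDl [h *: 1]mulr1.
apply: DeriveDef; first by rewrite /derivable E; exact: diff_derivable.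
by rewrite -diff_edot// -deriveE// /derive E.
Qed.

(** The mean value theorem along the segment; [P%:R] is the price of bounding the Euclidean pairing
    by maximum norms. *)
Lemma gradient_mean_value f g x y eps :
  (forall s : R, 0 <= s <= 1 -> differentiable f (y + s *: (x - y))
     /\ `|grad f (y + s *: (x - y)) - g| <= eps) ->
  `|f x - f y - edot g (x - y)| <= P%:R * eps * `|x - y|.
Proof.
set v := x - y => H.
have D (s : R) : 0 <= s <= 1 -> is_derive s (1 : R) (fun t => f (y + t *: v))
    (edot (grad f (y + s *: v)) v).
  by move=> s01; apply: is_derive_line; have [] := H s s01.
have [|s sI||s sI] := @MVT_segment _ (fun t => f (y + t *: v))
    (fun s => edot (grad f (y + s *: v)) v) 0 1.
- exact: ler01.
- by apply: D; move: sI; rewrite in_itv/= => /andP[/ltW -> /ltW ->].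
- apply: continuous_in_subspaceT => s; rewrite inE/= in_itv/= => s01.
  by apply: differentiable_continuous; apply/derivable1_diffP; have [] := D s s01.
rewrite scale1r scale0r addr0 subr0 mulr1 /v subrKC -/v => ->.
rewrite -edotBl; apply: (le_trans (edot_norm _ _)).
rewrite ler_wpM2r// ler_wpM2l//.
by have [] := H s sI.
Qed.

End coordinates.

Section uniform_C1.
Context {R : realType} {P : nat} {T : Type}.
Variables (x0 : 'rV[R]_P) (D : set T) (w : T -> R).
Hypothesis w_ge0 : forall t, 0 <= w t.
Implicit Types F : T -> 'rV[R]_P -> R.

(* Strict differentiability at x0, uniform in the family, stands in for the
   continuity of the derivatives. *)
Definition uniform_C1 F : Prop := exists G : T -> 'rV[R]_P,
  [/\ exists M, forall t, D t -> `|F t x0| <= M * w t /\ `|G t| <= M * w t,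
      \forall x \near x0, forall t, D t -> differentiable (F t) x
    & forall eps, 0 < eps -> \forall r \near 0^'+, forall t x y, D t ->
        `|x - x0| < r -> `|y - x0| < r ->
        `|F t x - F t y - edot (G t) (x - y)| <= eps * w t * `|x - y|].

(** Twice differentiability makes the gradient continuous at [x0]; near [x0] it stays within [e] of
    its value there, and [gradient_mean_value] converts this into strict differentiability. *)
Lemma uniform_C1_scale f (c : T -> R) (K : R) : twice_differentiable f x0 ->
  (forall t, D t -> `|c t| <= K * w t) -> uniform_C1 (fun t x => f x * c t).
Proof.
move=> [fd gd] cK; exists (fun t => c t *: grad f x0); split.
- exists (`|f x0| * K + K * `|grad f x0|) => t Dt; have ct := cK t Dt.
  have Kw : 0 <= K * w t by exact: le_trans ct.
  rewrite normrM normrZ.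
  have h1 := ler_wpM2l (normr_ge0 (f x0)) ct.
  have h2 := ler_wpM2r (normr_ge0 (grad f x0)) ct.
  have h3 := mulr_ge0 (normr_ge0 (f x0)) Kw.
  have h4 := mulr_ge0 (normr_ge0 (grad f x0)) Kw.
  by split; nra.
- apply: filterS fd => x fx t _.
  exact: differentiableM.
move=> eps eps0.
(* The final error is [P%:R * e] times a bound on the factors [c t]; the added ones keep the
   denominator positive when [P] or [K] is 0. *)
pose e := eps / ((P%:R + 1) * (`|K| + 1)).
have e0 : 0 < e.
  by rewrite divr_gt0// mulr_gt0// ltr_wpDl.
have gc : \forall x \near x0, `|grad f x - grad f x0| <= e.
  have /cvgr_dist_le/(_ _ e0) := differentiable_continuous gd.
  by apply: filterS => x; rewrite distrC.
have [r0 r00 r0P] := (nbhs_normP x0 _).1 (filterI fd gc).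
near=> r => t x y Dt xr yr.
have rr0 : r <= r0 by near: r; exact: nbhs_right_le.
have seg (s : R) : 0 <= s <= 1 -> `|x0 - (y + s *: (x - y))| < r0.
  move=> /andP[s0 s1]; apply: lt_le_trans rr0.
  have -> : x0 - (y + s *: (x - y)) = s *: (x0 - x) + (1 - s) *: (x0 - y).
    by apply/rowP => i; rewrite !mxE; ring.
  apply: (le_lt_trans (ler_normD _ _)); rewrite !normrZ (distrC x0 x).
  rewrite (distrC x0 y) (ger0_norm s0) ger0_norm ?subr_ge0//.
  have [ab|ba] := leP `|x - x0| `|y - x0|.
    by apply: le_lt_trans yr; have := ler_wpM2l s0 ab; lra.
  have s1' : 0 <= 1 - s by rewrite subr_ge0.
  by apply: le_lt_trans xr; have := ler_wpM2l s1' (ltW ba); lra.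
have := @gradient_mean_value _ _ f (grad f x0) x y e.
have h (s : R) (s01 : 0 <= s <= 1) := r0P _ (seg s s01).
move=> /(_ h) mv.
rewrite edotZl.
have -> : f x * c t - f y * c t - c t * edot (grad f x0) (x - y) =
  c t * (f x - f y - edot (grad f x0) (x - y)) by ring.
rewrite normrM.
have ct : `|c t| <= (`|K| + 1) * w t.
  apply: (le_trans (cK t Dt)); rewrite ler_wpM2r//.
  by rewrite (le_trans (ler_norm _))// lerDl.
have := ler_pM (normr_ge0 _) (normr_ge0 _) ct mv.
move=> /le_trans; apply.
have eE : eps = (P%:R + 1) * (`|K| + 1) * e.
  by rewrite /e mulrC divfK// gt_eqF// mulr_gt0// ltr_wpDl.
have -> : (`|K| + 1) * w t * (P%:R * e * `|x - y|) =
  ((`|K| + 1) * e * w t * `|x - y|) * P%:R by ring.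
have -> : eps * w t * `|x - y| = 
  ((`|K| + 1) * e * w t * `|x - y|) * (P%:R + 1) by rewrite eE; ring.
by rewrite ler_wpM2l ?lerDl// !mulr_ge0// ltW.
Unshelve. all: by end_near. Qed.

Lemma uniform_C1_add F1 F2 : uniform_C1 F1 -> uniform_C1 F2 ->
  uniform_C1 (fun t x => F1 t x + F2 t x).
Proof.
move=> [G1 [[M1 b1] d1 s1]] [G2 [[M2 b2] d2 s2]].
exists (fun t => G1 t + G2 t); split.
- exists (M1 + M2) => t Dt; have [p1 q1] := b1 t Dt; have [p2 q2] := b2 t Dt.
  by split; rewrite (le_trans (ler_normD _ _))// mulrDl lerD.
- by apply: filterS2 d1 d2 => x h1 h2 t Dt; apply: differentiableD; auto.
move=> eps eps0; have e2 : 0 < eps / 2 by lra.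
apply: filterS2 (s1 _ e2) (s2 _ e2) => r h1 h2 t x y Dt xr yr.
have := h1 t x y Dt xr yr; have := h2 t x y Dt xr yr.
rewrite edotDl !ler_norml; set a := edot _ _; set b := edot _ _.
set c := eps / 2 * w t * _; have -> : eps * w t * `|x - y| = c + c by rewrite /c; field.
lra.
Qed.

Lemma uniform_C1_sum n (F : 'I_n -> T -> 'rV[R]_P -> R) :
  (forall i, uniform_C1 (F i)) -> uniform_C1 (fun t x => \sum_i F i t x).
Proof.
elim: n F => [|n IHn] F HF.
  have -> : (fun t x => \sum_(i < 0) F i t x) = fun (_ : T) (_ : 'rV[R]_P) => 0.
    by apply/funext => t; apply/funext => x; rewrite big_ord0.
  exists (fun=> 0); split.
  - by exists 0 => t _; rewrite !normr0 mul0r.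
  - by near=> x => t _; exact: differentiable_cst.
  move=> eps eps0; near=> r => t x y _ _ _.
  rewrite subr0 sub0r /edot big1 ?oppr0 ?normr0; last first.
    by move=> i _; rewrite mxE mul0r.
  by rewrite !mulr_ge0// ltW.
have -> : (fun t x => \sum_(i < n.+1) F i t x) =
    fun t x => F ord0 t x + \sum_(i < n) F (lift ord0 i) t x.
  by apply/funext => t; apply/funext => x; rewrite big_ord_recl.
by apply: uniform_C1_add; [exact: HF|apply: IHn].
Unshelve. all: by end_near. Qed.

Lemma uniform_C1_lipschitz F : uniform_C1 F ->
  exists K, 0 <= K /\ \forall r \near 0^'+, forall t x y, D t ->
    `|x - x0| < r -> `|y - x0| < r ->
    `|F t x| <= K * w t /\ `|F t x - F t y| <= K * w t * `|x - y|.
Proof.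
move=> [G [[M b] _ s]].
(* The Lipschitz constant is the expansion error for [eps = 1] plus the slope [P%:R * |M|]; the
   further [|M|] bounds the value at [x0], from which [x] has distance at most 1. *)
pose N := `|M| + 1 + P%:R * `|M|.
exists (N + N); have N0 : 0 <= N by rewrite !addr_ge0// mulr_ge0.
split; first by rewrite addr_ge0.
have r_le1 : \forall r \near 0^'+, r <= (1 : R) by exact: nbhs_right_le.
apply: filterS2 (s 1 ltr01) r_le1 => r h r1 t x y Dt xr yr.
have [b1 b2] := b t Dt.
have MM : M * w t <= `|M| * w t by rewrite ler_wpM2r// ler_norm.
have Mw : 0 <= `|M| * w t by rewrite mulr_ge0.
have lip z z' : `|z - x0| < r -> `|z' - x0| < r ->
    `|F t z - F t z'| <= (1 + P%:R * `|M|) * w t * `|z - z'|.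
  move=> zr z'r; have := h t z z' Dt zr z'r.
  have := edot_norm (G t) (z - z').
  set E := edot _ _ => hE hF.
  have -> : F t z - F t z' = (F t z - F t z' - E) + E by ring.
  apply: (le_trans (ler_normD _ _)); rewrite !mulrDl lerD//.
  apply: (le_trans hE); rewrite ler_wpM2r// -mulrA ler_wpM2l//.
  exact: le_trans MM.
have PM : 0 <= P%:R * `|M| * w t by rewrite -mulrA mulr_ge0.
have wt := w_ge0 t.
split; last first.
  apply: (le_trans (lip _ _ xr yr)); rewrite ler_wpM2r// ler_wpM2r// /N.
  by have := normr_ge0 M; have := mulr_ge0 (ler0n R P) (normr_ge0 M); lra.
have r0 : `|x0 - x0| < r by rewrite subrr normr0 (le_lt_trans _ xr).
have l := lip _ _ xr r0.
have xr1 : `|x - x0| <= 1 by rewrite (le_trans (ltW xr)).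
rewrite -[F t x](subrK (F t x0)).
apply: (le_trans (ler_normD _ _)); rewrite [leRHS]mulrDl lerD//.
  apply: (le_trans l); apply: (@le_trans _ _ ((1 + P%:R * `|M|) * w t)).
    by rewrite ler_piMr// mulr_ge0// addr_ge0// mulr_ge0.
  by rewrite /N; apply: ler_wpM2r => //; have := normr_ge0 M; lra.
rewrite (le_trans b1)// (le_trans MM)// /N ler_wpM2r//.
by have := mulr_ge0 (ler0n R P) (normr_ge0 M); lra.
Qed.

End uniform_C1.

(** * Stability of the reduced solutions *)

Section galerkin_estimates.
Context {R : realType} {V : completeNormedModType R} {P : nat}.
Variables (pb : problem V P).
Implicit Types (B : set 'rV[R]_P) (W : set V) (S : rb_spaces V).
Implicit Types (x y mu : 'rV[R]_P).

Definition lipschitz_forms B W (M : R) (b : 'rV[R]_P -> V -> V -> R) : Prop :=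
  forall x y u v, B x -> B y -> W u -> W v ->
    `|b x u v| <= M * (`|u| * `|v|) /\
    `|b x u v - b y u v| <= M * (`|u| * `|v|) * `|x - y|.

Definition lipschitz_functionals B W (M : R) (f : 'rV[R]_P -> V -> R) : Prop :=
  forall x y v, B x -> B y -> W v ->
    `|f x v| <= M * `|v| /\ `|f x v - f y v| <= M * `|v| * `|x - y|.

(** [B] will be a ball around a point of the parameter box and may reach outside it, so these bounds
    cannot be read off [well_posed]; they are required on [Vh] only. *)
Record regular_near B (M c : R) : Prop := RegularNear {
  Vh_fd : finite_dim_subspace (Vh pb);
  coer_gt0 : 0 < c;
  lip_ge0 : 0 <= M;
  lip_a : lipschitz_forms B (Vh pb) M (fun x => a_ pb x);
  lip_k : lipschitz_forms B (Vh pb) M (fun x => k_ pb x);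
  lip_l : lipschitz_functionals B (Vh pb) M (fun x => l_ pb x);
  lip_j : lipschitz_functionals B (Vh pb) M (fun x => j_ pb x);
  coer_a : forall x v, B x -> Vh pb v -> c * `|v| ^+ 2 <= a_ pb x v v }.

Record rb_in_Vh S : Prop := RBInVh {
  Vpr_fd : finite_dim_subspace (Vpr S);
  Vpr_sub : Vpr S `<=` Vh pb;
  Vdu_fd : finite_dim_subspace (Vdu S);
  Vdu_sub : Vdu S `<=` Vh pb }.

(** The estimates test the dual residual with primal errors and the primal residual with dual
    errors. Orthogonality to the reduced space of the same residual would not cover these, hence
    test vectors from all of [Vh]. *)
Definition exact_at S mu : Prop := forall v, Vh pb v ->
  res_pr pb mu (u_r pb S mu) v = 0 /\
  res_du pb mu (u_r pb S mu) (p_r pb S mu) v = 0.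

Definition fom_spaces : rb_spaces V := RBSpaces (Vh pb) (Vh pb).

Lemma bilinear_a x : bilinear_form (a_ pb x).
Proof. by split=> v a u w; [rewrite linearPl|rewrite linearPr]. Qed.

Lemma bilinear_a_swap x : bilinear_form (fun p v => a_ pb x v p).
Proof. by split=> v a u w; [rewrite linearPr|rewrite linearPl]. Qed.

Lemma scalar_l x : scalar (l_ pb x).
Proof. by move=> a u v; rewrite linearP. Qed.

Lemma scalar_dual_rhs x u : scalar (dual_rhs pb x u).
Proof. by move=> a v w; rewrite /dual_rhs linearP linearPl; ring. Qed.

Lemma definite_coercive W W' (c : R) (b : V -> V -> R) : 0 < c -> W `<=` W' ->
  (forall v, W' v -> c * `|v| ^+ 2 <= b v v) -> definite_on W b.
Proof.
move=> c0 WW' bc v Wv bv0.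
have := bc v (WW' v Wv); rewrite bv0 pmulr_rle0// => v0.
by apply/normr0_eq0/eqP; rewrite -sqrf_eq0 eq_le v0 sqr_ge0.
Qed.

Section regular.
Variables (B : set 'rV[R]_P) (M c : R).
Hypothesis reg : regular_near B M c.

Lemma definite_a W x : B x -> W `<=` Vh pb -> definite_on W (a_ pb x).
Proof.
move=> Bx WVh; apply: (definite_coercive (coer_gt0 reg) WVh) => v Vhv.
exact: (coer_a reg Bx).
Qed.

Lemma u_rP S x : rb_in_Vh S -> B x -> Vpr S (u_r pb S x) /\
  forall v, Vpr S v -> a_ pb x (u_r pb S x) v = l_ pb x v.
Proof.
move=> okS Bx; apply: galerkinP (Vpr_fd okS) (bilinear_a x) (scalar_l x) _.
exact: definite_a (Vpr_sub okS).
Qed.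

Lemma p_rP S x : rb_in_Vh S -> B x -> Vdu S (p_r pb S x) /\
  forall v, Vdu S v -> a_ pb x v (p_r pb S x) = dual_rhs pb x (u_r pb S x) v.
Proof.
move=> okS Bx; apply: galerkinP (Vdu_fd okS) (bilinear_a_swap x) _ _.
  exact: scalar_dual_rhs.
exact: definite_a (Vdu_sub okS).
Qed.

Lemma u_r_Vh S x : rb_in_Vh S -> B x -> Vh pb (u_r pb S x).
Proof. by move=> okS Bx; apply: (Vpr_sub okS); have [] := u_rP okS Bx. Qed.

Lemma p_r_Vh S x : rb_in_Vh S -> B x -> Vh pb (p_r pb S x).
Proof. by move=> okS Bx; apply: (Vdu_sub okS); have [] := p_rP okS Bx. Qed.

Lemma rb_in_Vh_fom : rb_in_Vh fom_spaces.
Proof. by split=> //; exact: Vh_fd reg. Qed.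

Lemma exact_at_fom mu : B mu -> exact_at fom_spaces mu.
Proof.
move=> Bmu v Vhv; rewrite /res_pr /res_du.
have [_ ->//] := u_rP rb_in_Vh_fom Bmu.
by have [_ ->//] := p_rP rb_in_Vh_fom Bmu; rewrite !subrr.
Qed.

Lemma u_r_snapshot S mu : rb_in_Vh S -> B mu -> Vpr S (u_h pb mu) ->
  u_r pb S mu = u_h pb mu.
Proof.
move=> okS Bmu Su.
apply: galerkin_unique (Vpr_fd okS) (bilinear_a _) (scalar_l _) _ Su _.
  exact: definite_a (Vpr_sub okS).
move=> v Sv; have [_ ->//] := u_rP rb_in_Vh_fom Bmu.
exact: Vpr_sub Sv.
Qed.

Lemma p_r_snapshot S mu : rb_in_Vh S -> B mu -> Vpr S (u_h pb mu) ->
  Vdu S (p_h pb mu) -> p_r pb S mu = p_h pb mu.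
Proof.
move=> okS Bmu Su Sp.
rewrite /p_r u_r_snapshot//.
apply: galerkin_unique (Vdu_fd okS) (bilinear_a_swap _) _ _ Sp _.
- exact: scalar_dual_rhs.
- exact: definite_a (Vdu_sub okS).
move=> v Sv; have [_ ->//] := p_rP rb_in_Vh_fom Bmu.
exact: Vdu_sub Sv.
Qed.

Lemma coercive_norm_le x v (A : R) : B x -> Vh pb v -> 0 <= A ->
  a_ pb x v v <= A * `|v| -> `|v| <= A / c.
Proof.
move=> Bx Vhv A0 av; have c0 := coer_gt0 reg.
rewrite ler_pdivlMr//.
have := le_trans (coer_a reg Bx Vhv) av.
have [->|v0] := eqVneq `|v| 0; first by rewrite mul0r.
have vp : 0 < `|v| by rewrite lt_neqAle eq_sym v0 normr_ge0.
by rewrite expr2 mulrA ler_pM2r// mulrC.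
Qed.

(* Each difference solves the Galerkin problem at x for the residual, at x, of
   the solution at y; that residual vanishes at y. *)
Lemma rb_solution_lipschitz : exists C, 0 <= C /\ forall S x y,
  rb_in_Vh S -> B x -> B y ->
  [/\ `|u_r pb S x| <= C, `|p_r pb S x| <= C,
      `|u_r pb S x - u_r pb S y| <= C * `|x - y|
    & `|p_r pb S x - p_r pb S y| <= C * `|x - y|].
Proof.
have c0 := coer_gt0 reg; have M0 := lip_ge0 reg.
(* [U] and [Q] bound the primal and dual solutions, [DU] and [DQ] are their Lipschitz constants;
   each is the bound that [coercive_norm_le] gives for the corresponding right-hand side. *)
pose U := M / c; pose Q := (M + 2 * M * U) / c.
pose DU := (M + M * U) / c; pose DQ := (M + 2 * M * U + 2 * M * DU + M * Q) / c.
have ci0 : 0 <= c^-1 by rewrite invr_ge0 ltW.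
have U0 : 0 <= U by rewrite mulr_ge0.
have Q0 : 0 <= Q by rewrite !(mulr_ge0, addr_ge0).
have DU0 : 0 <= DU by rewrite !(mulr_ge0, addr_ge0).
have DQ0 : 0 <= DQ by rewrite !(mulr_ge0, addr_ge0).
have Ub S x : rb_in_Vh S -> B x -> `|u_r pb S x| <= U.
  move=> okS Bx; have [Su uP] := u_rP okS Bx.
  apply: (@coercive_norm_le x) => //; first exact: u_r_Vh.
  rewrite uP//; apply: le_trans (ler_norm _) _.
  by have [] := lip_l reg Bx Bx (u_r_Vh okS Bx).
have Qb S x : rb_in_Vh S -> B x -> `|p_r pb S x| <= Q.
  move=> okS Bx; have [Sp pP] := p_rP okS Bx; have Ux := Ub _ _ okS Bx.
  have up := u_r_Vh okS Bx; have pp := p_r_Vh okS Bx.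
  apply: (@coercive_norm_le x) => //; first by rewrite addr_ge0// !mulr_ge0.
  rewrite pP//; apply: le_trans (ler_norm _) _.
  rewrite /dual_rhs; apply: (le_trans (ler_normD _ _)); rewrite [leRHS]mulrDl; apply: lerD.
    by have [] := lip_j reg Bx Bx pp.
  have -> : 2 * M * U * `|p_r pb S x| = 2 * (M * (U * `|p_r pb S x|)) by ring.
  rewrite normrM ger0_norm// ler_wpM2l//.
  have [+ _] := lip_k reg Bx Bx pp up.
  by move=> /le_trans; apply; rewrite ler_wpM2l// [leLHS]mulrC ler_wpM2r.
have DUb S x y : rb_in_Vh S -> B x -> B y ->
    `|u_r pb S x - u_r pb S y| <= DU * `|x - y|.
  move=> okS Bx By.
  have [Sx xP] := u_rP okS Bx; have [Sy yP] := u_rP okS By.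
  have Se := finite_dim_subspaceB (Vpr_fd okS) Sx Sy.
  set e := u_r pb S x - u_r pb S y in Se *.
  have Ve := Vpr_sub okS Se; have Vy := Vpr_sub okS Sy.
  rewrite /DU mulrAC; apply: (@coercive_norm_le x) => //.
    by rewrite mulr_ge0// addr_ge0// mulr_ge0.
  have -> : a_ pb x e e = (l_ pb x e - l_ pb y e)
      - (a_ pb x (u_r pb S y) e - a_ pb y (u_r pb S y) e).
    by rewrite {1}/e linearBl xP// yP//; ring.
  apply: le_trans (ler_norm _) _; apply: le_trans (ler_normB _ _) _.
  have [_ h1] := lip_l reg Bx By Ve; have [_ h2] := lip_a reg Bx By Vy Ve.
  have h3 : M * (`|u_r pb S y| * `|e|) * `|x - y| <= M * (U * `|e|) * `|x - y|.
    by rewrite ler_wpM2r// ler_wpM2l// ler_wpM2r// Ub.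
  lra.
have DQb S x y : rb_in_Vh S -> B x -> B y ->
    `|p_r pb S x - p_r pb S y| <= DQ * `|x - y|.
  move=> okS Bx By.
  have [Sx xP] := p_rP okS Bx; have [Sy yP] := p_rP okS By.
  have Vux := u_r_Vh okS Bx; have Vuy := u_r_Vh okS By.
  have Vdu := finite_dim_subspaceB (Vh_fd reg) Vux Vuy.
  have Se := finite_dim_subspaceB (Vdu_fd okS) Sx Sy.
  have hU := Ub _ _ okS By; have hQ := Qb _ _ okS By; have hD := DUb _ _ _ okS Bx By.
  set e := p_r pb S x - p_r pb S y in Se *.
  have Ve := Vdu_sub okS Se; have Vy := Vdu_sub okS Sy.
  rewrite /DQ mulrAC; apply: (@coercive_norm_le x) => //.
    by rewrite !(mulr_ge0, addr_ge0).
  have -> : a_ pb x e e = (j_ pb x e - j_ pb y e)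
      + 2 * (k_ pb x e (u_r pb S y) - k_ pb y e (u_r pb S y))
      + 2 * k_ pb x e (u_r pb S x - u_r pb S y)
      - (a_ pb x e (p_r pb S y) - a_ pb y e (p_r pb S y)).
    have -> : a_ pb x e e = a_ pb x e (p_r pb S x) - a_ pb x e (p_r pb S y).
      by rewrite -linearBr.
    rewrite (linearBr (k_ pb x)) xP// yP// /dual_rhs; ring.
  apply: le_trans (ler_norm _) _; apply: le_trans (ler_normB _ _) _.
  apply: le_trans (lerD (ler_normD _ _) (lexx _)) _.
  apply: le_trans (lerD (lerD (ler_normD _ _) (lexx _)) (lexx _)) _.
  rewrite !(normrM 2) (ger0_norm (ler0n _ 2)).
  have [_ h1] := lip_j reg Bx By Ve; have [_ h2] := lip_a reg Bx By Ve Vy.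
  have [_ h3] := lip_k reg Bx By Ve Vuy; have [h4 _] := lip_k reg Bx By Ve Vdu.
  have h2' : M * (`|e| * `|p_r pb S y|) * `|x - y| <= M * (`|e| * Q) * `|x - y|.
    by rewrite ler_wpM2r// ler_wpM2l// ler_wpM2l.
  have h3' : M * (`|e| * `|u_r pb S y|) * `|x - y| <= M * (`|e| * U) * `|x - y|.
    by rewrite ler_wpM2r// ler_wpM2l// ler_wpM2l.
  have h4' : M * (`|e| * `|u_r pb S x - u_r pb S y|) <= M * (`|e| * (DU * `|x - y|)).
    by rewrite ler_wpM2l// ler_wpM2l.
  lra.
exists (U + Q + DU + DQ); split; first by rewrite !addr_ge0.
move=> S x y okS Bx By; split.
- by rewrite (le_trans (Ub _ _ okS Bx))//; lra.
- by rewrite (le_trans (Qb _ _ okS Bx))//; lra.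
- by rewrite (le_trans (DUb _ _ _ okS Bx By))// ler_wpM2r//; lra.
- by rewrite (le_trans (DQb _ _ _ okS Bx By))// ler_wpM2r//; lra.
Qed.

End regular.
End galerkin_estimates.

(** * Second-order estimates of the model and of its error estimator *)

Section estimator_constants.
Context {R : realType} {V : completeNormedModType R}.
Implicit Types (W : set V) (b : V -> V -> R) (f : V -> R).

Lemma dual_norm_bounds W f (K : R) : W 0 -> 0 <= K ->
  (forall v, W v -> `|f v| <= K * `|v|) -> 0 <= dual_norm W f <= K.
Proof.
move=> W0 K0 fK; rewrite /dual_norm; set E := [set _ | _ in _].
have E0 : E `|f 0| by exists 0 => //; split; rewrite ?normr0.
have EK : ubound E K.
  move=> _ [v [Wv v1] <-]; apply: (le_trans (fK v Wv)).
  by rewrite ler_piMr.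
apply/andP; split; last by apply: ge_sup => //; exists `|f 0|.
apply: le_trans (normr_ge0 (f 0)) _.
by apply: ub_le_sup => //; exists K.
Qed.

Lemma continuity_constant_le W b (K : R) : W 0 -> 0 <= K ->
  (forall u v, W u -> W v -> `|b u v| <= K * (`|u| * `|v|)) ->
  continuity_constant W b <= K.
Proof.
move=> W0 K0 bK; apply: ge_sup.
  by exists `|b 0 0|; exists 0, 0; split; rewrite ?normr0.
move=> _ [u [v [Wu Wv u1 v1 ->]]]; apply: (le_trans (bK u v Wu Wv)).
by rewrite ler_piMr// mulr_ile1.
Qed.

Lemma coercivity_constant_inv W b (c : R) : 0 < c ->
  (forall v, W v -> c * `|v| ^+ 2 <= b v v) ->
  0 <= (coercivity_constant W b)^-1 <= c^-1.
Proof.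
move=> c0 bc; rewrite /coercivity_constant; set E := [set _ | _ in _].
(* If [W] has no nonzero vector, the infimum of the empty set is 0 and so is its inverse; the bounds
   hold for these default values too. *)
have [->|/set0P E0] := eqVneq E set0.
  by rewrite inf0 invr0 lexx invr_ge0 ltW.
have cE : c <= inf E.
  apply: lb_le_inf => // _ [v [Wv v0] <-].
  by rewrite ler_pdivlMr ?bc// exprn_gt0// normr_gt0.
have E_gt0 := lt_le_trans c0 cE.
by rewrite invr_ge0 (ltW E_gt0) lef_pV2.
Qed.

End estimator_constants.

Section second_order.
Context {R : realType} {V : completeNormedModType R} {P : nat}.
Variables (pb : problem V P) (B : set 'rV[R]_P) (M c : R).
Hypothesis reg : regular_near pb B M c.
Implicit Types (S : rb_spaces V) (x mu : 'rV[R]_P) (u p v : V).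

Definition lagrangian u p x : R := cost pb u x + res_pr pb x u p.

Lemma res_pr_lipschitz x mu u v : B x -> B mu -> Vh pb u -> Vh pb v ->
  res_pr pb mu u v = 0 ->
  `|res_pr pb x u v| <= M * (1 + `|u|) * `|v| * `|x - mu|.
Proof.
move=> Bx Bmu Vu Vv r0; have M0 := lip_ge0 reg.
have -> : res_pr pb x u v =
    (l_ pb x v - l_ pb mu v) - (a_ pb x u v - a_ pb mu u v).
  by rewrite -[LHS]subr0 -r0 /res_pr; ring.
apply: le_trans (ler_normB _ _) _.
have [_ h1] := lip_l reg Bx Bmu Vv; have [_ h2] := lip_a reg Bx Bmu Vu Vv.
lra.
Qed.

Lemma res_du_lipschitz x mu u p v : B x -> B mu -> Vh pb u -> Vh pb p ->
  Vh pb v -> res_du pb mu u p v = 0 ->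
  `|res_du pb x u p v| <= M * (1 + 2 * `|u| + `|p|) * `|v| * `|x - mu|.
Proof.
move=> Bx Bmu Vu Vp Vv r0; have M0 := lip_ge0 reg.
have -> : res_du pb x u p v =
    (j_ pb x v - j_ pb mu v) + 2 * (k_ pb x v u - k_ pb mu v u)
    - (a_ pb x v p - a_ pb mu v p).
  by rewrite -[LHS]subr0 -r0 /res_du /dual_rhs; ring.
apply: le_trans (ler_normB _ _) _.
apply: le_trans (lerD (ler_normD _ _) (lexx _)) _.
rewrite (normrM 2) (ger0_norm (ler0n _ 2)).
have [_ h1] := lip_j reg Bx Bmu Vv; have [_ h2] := lip_k reg Bx Bmu Vv Vu.
have [_ h3] := lip_a reg Bx Bmu Vv Vp.
lra.
Qed.

(** An exact identity, as the cost is quadratic in the state. The antisymmetric part of [k_] at [x]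
    is kept because [x] may lie outside the box; where [k_] is symmetric at [mu], it is of second
    order. *)
Lemma Jr_expansion S x mu :
  let u := u_r pb S mu in let p := p_r pb S mu in
  let e := u_r pb S x - u in let d := p_r pb S x - p in
  Jr pb S x - lagrangian u p x =
  res_du pb x u p e + (k_ pb x u e - k_ pb x e u) + k_ pb x e e
  + res_pr pb x u d - a_ pb x e d.
Proof.
move=> u p e d; rewrite /Jr /lagrangian.
have -> : u_r pb S x = u + e by rewrite addrC subrK.
have -> : p_r pb S x = p + d by rewrite addrC subrK.
clearbody e d; rewrite /cost /res_pr /res_du /dual_rhs.
rewrite !linearD/= !(linearDl (k_ pb x)) !(linearDl (a_ pb x)).
ring.
Qed.

(* The terms linear in the errors of the primal and dual solutions are the
   residuals of mu taken at x, so every term is of second order. *)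
Lemma Jr_second_order : exists C : R, 0 <= C /\ forall S x mu,
  rb_in_Vh pb S -> B x -> B mu -> exact_at pb S mu ->
  Defs.symmetric_form (k_ pb mu) ->
  `|Jr pb S x - lagrangian (u_r pb S mu) (p_r pb S mu) x|
    <= C * `|x - mu| ^+ 2.
Proof.
have M0 := lip_ge0 reg.
have [L [L0 sol]] := rb_solution_lipschitz reg.
(* The summands bound, in this order, the terms of [Jr_expansion]; the second one stands for the two
   increments that make up the antisymmetric part. *)
exists (M * (1 + 3 * L) * L + 2 * (M * L * L) + M * L * L + M * (1 + L) * L + M * L * L).
split; first by rewrite !(mulr_ge0, addr_ge0).
move=> S x mu okS Bx Bmu ex ksym.
have Vx := u_r_Vh reg okS Bx; have Vu := u_r_Vh reg okS Bmu.
have Vpx := p_r_Vh reg okS Bx; have Vp := p_r_Vh reg okS Bmu.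
have := Jr_expansion S x mu => /= ->.
have [_ _ eb db] := sol S x mu okS Bx Bmu.
have [ub pb' _ _] := sol S mu x okS Bmu Bx.
have Ve := finite_dim_subspaceB (Vh_fd reg) Vx Vu.
have Vd := finite_dim_subspaceB (Vh_fd reg) Vpx Vp.
set u := u_r pb S mu in Vu ub eb Ve *; set p := p_r pb S mu in Vp pb' db Vd *.
set e := u_r pb S x - u in eb Ve *; set d := p_r pb S x - p in db Vd *.
set h := `|x - mu| in eb db *; have h0 : 0 <= h by exact: normr_ge0.
have [_ rdu0] := ex e Ve; have [rpr0 _] := ex d Vd.
have b1 := res_du_lipschitz Bx Bmu Vu Vp Ve rdu0.
have b2 := res_pr_lipschitz Bx Bmu Vu Vd rpr0.
have [_ b3] := lip_k reg Bx Bmu Vu Ve; have [_ b4] := lip_k reg Bx Bmu Ve Vu.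
have [b5 _] := lip_k reg Bx Bx Ve Ve; have [b6 _] := lip_a reg Bx Bx Ve Vd.
rewrite -/h in b1 b2 b3 b4.
have -> : k_ pb x u e - k_ pb x e u =
    (k_ pb x u e - k_ pb mu u e) - (k_ pb x e u - k_ pb mu e u).
  by rewrite (ksym u e); ring.
have c1 : `|res_du pb x u p e| <= M * (1 + 3 * L) * (L * h) * h.
  apply: (le_trans b1); rewrite ler_wpM2r// ler_pM ?mulr_ge0 ?addr_ge0 ?mulr_ge0//.
  by rewrite ler_wpM2l//; lra.
have c2 : `|res_pr pb x u d| <= M * (1 + L) * (L * h) * h.
  apply: (le_trans b2); rewrite ler_wpM2r// ler_pM ?mulr_ge0 ?addr_ge0 ?mulr_ge0//.
  by rewrite ler_wpM2l// lerD2l.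
have c3 : `|k_ pb x u e - k_ pb mu u e| <= M * (L * (L * h)) * h.
  by apply: (le_trans b3); rewrite ler_wpM2r// ler_wpM2l// ler_pM.
have c4 : `|k_ pb x e u - k_ pb mu e u| <= M * (L * h * L) * h.
  by apply: (le_trans b4); rewrite ler_wpM2r// ler_wpM2l// ler_pM.
have c5 : `|k_ pb x e e| <= M * (L * h * (L * h)).
  by apply: (le_trans b5); rewrite ler_wpM2l// ler_pM.
have c6 : `|a_ pb x e d| <= M * (L * h * (L * h)).
  by apply: (le_trans b6); rewrite ler_wpM2l// ler_pM.
apply: le_trans (ler_normB _ _) _.
apply: le_trans (lerD (ler_normD _ _) (lexx _)) _.
apply: le_trans (lerD (lerD (ler_normD _ _) (lexx _)) (lexx _)) _.
apply: le_trans (lerD (lerD (lerD (ler_normD _ _) (lexx _)) (lexx _)) (lexx _)) _.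
apply: le_trans (lerD (lerD (lerD (lerD (lexx _) (ler_normB _ _)) (lexx _)) (lexx _)) (lexx _)) _.
lra.
Qed.

(** Both residuals are of first order in [x - mu], since they vanish at [mu] and the solutions are
    Lipschitz, and the estimator is quadratic in the residual norms. *)
Lemma Delta_J_second_order : exists C : R, 0 <= C /\ forall S x mu,
  rb_in_Vh pb S -> B x -> B mu -> exact_at pb S mu ->
  Delta_J pb S x <= C * `|x - mu| ^+ 2.
Proof.
have M0 := lip_ge0 reg; have c0 := coer_gt0 reg.
have [L [L0 sol]] := rb_solution_lipschitz reg.
(* To the constants for the residuals of the solutions at [mu], [M * (1 + L)] and [M * (1 + 3 * L)],
   these add the effect of replacing those solutions by the ones at [x]. *)
pose K1 := M * (1 + 2 * L); pose K2 := M * (1 + 6 * L).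
have K10 : 0 <= K1 by rewrite !(mulr_ge0, addr_ge0).
have K20 : 0 <= K2 by rewrite !(mulr_ge0, addr_ge0).
have ci0 : 0 <= c^-1 by rewrite invr_ge0 ltW.
exists (c^-1 * K1 * K2 + (c^-1 * K1) ^+ 2 * M).
split; first by rewrite !(mulr_ge0, addr_ge0, exprn_ge0).
move=> S x mu okS Bx Bmu ex.
have Vx := u_r_Vh reg okS Bx; have Vu := u_r_Vh reg okS Bmu.
have Vpx := p_r_Vh reg okS Bx; have Vp := p_r_Vh reg okS Bmu.
have [_ _ eb db] := sol S x mu okS Bx Bmu.
have [ub pb' _ _] := sol S mu x okS Bmu Bx.
have Ve := finite_dim_subspaceB (Vh_fd reg) Vx Vu.
have Vd := finite_dim_subspaceB (Vh_fd reg) Vpx Vp.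
have V0 := finite_dim_subspace0 (Vh_fd reg).
have r1 v : Vh pb v -> `|res_pr pb x (u_r pb S x) v| <= K1 * `|x - mu| * `|v|.
  move=> Vv; have [rpr0 _] := ex v Vv.
  have b1 := res_pr_lipschitz Bx Bmu Vu Vv rpr0.
  have [b2 _] := lip_a reg Bx Bx Ve Vv.
  have -> : res_pr pb x (u_r pb S x) v = res_pr pb x (u_r pb S mu) v
      - a_ pb x (u_r pb S x - u_r pb S mu) v.
    by rewrite /res_pr linearBl; ring.
  apply: le_trans (ler_normB _ _) _.
  have c1 : M * (1 + `|u_r pb S mu|) * `|v| * `|x - mu| <= M * (1 + L) * `|v| * `|x - mu|.
    by rewrite ler_wpM2r// ler_wpM2r// ler_wpM2l// lerD2l.
  have c2 : M * (`|u_r pb S x - u_r pb S mu| * `|v|) <= M * (L * `|x - mu| * `|v|).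
    by rewrite ler_wpM2l// ler_wpM2r.
  rewrite /K1; lra.
have r2 v : Vh pb v ->
    `|res_du pb x (u_r pb S x) (p_r pb S x) v| <= K2 * `|x - mu| * `|v|.
  move=> Vv; have [_ rdu0] := ex v Vv.
  have b1 := res_du_lipschitz Bx Bmu Vu Vp Vv rdu0.
  have [b2 _] := lip_k reg Bx Bx Vv Ve.
  have [b3 _] := lip_a reg Bx Bx Vv Vd.
  have -> : res_du pb x (u_r pb S x) (p_r pb S x) v =
      res_du pb x (u_r pb S mu) (p_r pb S mu) v
      + 2 * k_ pb x v (u_r pb S x - u_r pb S mu)
      - a_ pb x v (p_r pb S x - p_r pb S mu).
    by rewrite /res_du /dual_rhs (linearBr (k_ pb x)) (linearBr (a_ pb x)); ring.
  apply: le_trans (ler_normB _ _) _.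
  apply: le_trans (lerD (ler_normD _ _) (lexx _)) _.
  rewrite (normrM 2) (ger0_norm (ler0n _ 2)).
  have c1 : M * (1 + 2 * `|u_r pb S mu| + `|p_r pb S mu|) * `|v| * `|x - mu|
      <= M * (1 + 3 * L) * `|v| * `|x - mu|.
    by rewrite ler_wpM2r// ler_wpM2r// ler_wpM2l//; lra.
  have c2 : M * (`|v| * `|u_r pb S x - u_r pb S mu|) <= M * (`|v| * (L * `|x - mu|)).
    by rewrite ler_wpM2l// ler_wpM2l.
  have c3 : M * (`|v| * `|p_r pb S x - p_r pb S mu|) <= M * (`|v| * (L * `|x - mu|)).
    by rewrite ler_wpM2l// ler_wpM2l.
  rewrite /K2; lra.
set h := `|x - mu| in r1 r2 *; have h0 : 0 <= h by exact: normr_ge0.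
have /andP[n10 n1] := dual_norm_bounds V0 (mulr_ge0 K10 h0) r1.
have /andP[n20 n2] := dual_norm_bounds V0 (mulr_ge0 K20 h0) r2.
have /andP[a0 ac] := coercivity_constant_inv c0 (fun v => @coer_a _ _ _ _ _ _ _ reg x v Bx).
have kc : continuity_constant (Vh pb) (k_ pb x) <= M.
  by apply: continuity_constant_le => // u v Vu' Vv'; have [] := lip_k reg Bx Bx Vu' Vv'.
have D0 : 0 <= Delta_pr pb S x by rewrite mulr_ge0.
have D1 : Delta_pr pb S x <= c^-1 * (K1 * h) by rewrite ler_pM.
rewrite /Delta_J.
have e1 := ler_pM D0 n20 D1 n2.
have e2 : Delta_pr pb S x ^+ 2 * continuity_constant (Vh pb) (k_ pb x)
    <= (c^-1 * (K1 * h)) ^+ 2 * M.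
  apply: (le_trans (ler_wpM2l (sqr_ge0 _) kc)); rewrite ler_wpM2r//.
  by rewrite !expr2 ler_pM.
apply: (le_trans (lerD e1 e2)); rewrite le_eqVlt; apply/orP; left; apply/eqP.
ring.
Qed.

End second_order.

(** * Gradients of the models *)

Section derivative_comparison.
Context {R : realType} {P : nat}.
Implicit Types (f g : 'rV[R]_P -> R) (y v G : 'rV[R]_P).

Lemma near_line y v (s : R) : 0 < s ->
  \forall h \near (0 : R)^', `|h *: v| < s.
Proof.
move=> s0.
have p0 : 0 < `|v| + 1 by rewrite ltr_wpDl.
near=> h; rewrite normrZ.
apply: (@le_lt_trans _ _ (`|h| * (`|v| + 1))).
  by rewrite ler_wpM2l// lerDl.
rewrite -ltr_pdivlMr//; near: h; apply: dnbhs0_lt.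
by rewrite divr_gt0.
Unshelve. all: by end_near. Qed.

Lemma derive_slope_le f y v (b e : R) : derivable f y v ->
  (\forall h \near (0 : R)^', `|f (h *: v + y) - f y - h * b| <= e * `|h|) ->
  `|'D_v f y - b| <= e.
Proof.
move=> df slope; apply/ler_addgt0Pr => eta eta0.
near (0 : R)^' => h.
have h0 : h != 0 by near: h; exact: nbhs_dnbhs_neq.
have H1 : `|'D_v f y - h^-1 *: (f (h *: v + y) - f y)| <= eta.
  near: h.
  have : (fun h => h^-1 *: ((f \o shift y) (h *: v) - f y)) @ 0^' --> 'D_v f y.
    exact: df.
  by move=> /cvgr_dist_le/(_ _ eta0); apply: filterS.
have H2 : `|f (h *: v + y) - f y - h * b| <= e * `|h| by near: h.
have -> : 'D_v f y - b = ('D_v f y - h^-1 *: (f (h *: v + y) - f y))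
    + h^-1 * (f (h *: v + y) - f y - h * b).
  by rewrite /GRing.scale/=; field.
rewrite addrC (le_trans (ler_normD _ _))// lerD//.
by rewrite normrM normfV mulrC ler_pdivrMr ?normr_gt0.
Unshelve. all: by end_near. Qed.

Lemma grad_strict f y G (s e : R) : 0 < s -> 0 <= e -> differentiable f y ->
  (forall x, `|x - y| < s -> `|f x - f y - edot G (x - y)| <= e * `|x - y|) ->
  `|grad f y - G| <= e.
Proof.
move=> s0 e0 df fG; apply: norm_le_coord => // i; rewrite !mxE.
apply: derive_slope_le; first exact: diff_derivable.
apply: filterS (near_line y (delta_mx 0 i) s0) => h hs.
have := fG (h *: delta_mx 0 i + y); rewrite addrK => /(_ hs).
rewrite edotZr edot_delta => /le_trans; apply.
rewrite ler_wpM2l// normrZ ler_piMr//.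
by apply: norm_le_coord => // j; rewrite mxE/= ger0_norm// lern1 leq_b1.
Qed.

(** The difference quotients of [f] and [g] in direction [v] differ by at most [C * |h| * |v| ^+ 2],
    so those of [f] inherit the limits. This is how the gradient of [Jr] is obtained from that of
    the Lagrangian. *)
Lemma grad_second_order f g y (s C : R) : 0 < s -> differentiable g y ->
  (forall x, `|x - y| < s -> `|f x - g x| <= C * `|x - y| ^+ 2) ->
  grad f y = grad g y.
Proof.
move=> s0 dg fg.
have fgy : f y = g y.
  have := fg y; rewrite subrr normr0 expr0n mulr0 normr_le0 subr_eq0.
  by move=> /(_ s0)/eqP.
apply/rowP => i; rewrite !mxE; set v := delta_mx 0 i.
have dgv : (fun h => h^-1 *: ((g \o shift y) (h *: v) - g y)) @ 0^'
    --> 'D_v g y by have : derivable g y v by exact: diff_derivable.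
apply: cvg_lim => //; apply/cvgrPdist_le => eps eps0.
have eps2 : 0 < eps / 2 by rewrite divr_gt0.
have Cp : 0 < (`|C| + 1) * (`|v| ^+ 2 + 1).
  by rewrite mulr_gt0// ltr_wpDl// exprn_ge0.
near=> h.
have h0 : h != 0 by near: h; exact: nbhs_dnbhs_neq.
have H1 : `|'D_v g y - h^-1 *: (g (h *: v + y) - g y)| <= eps / 2.
  by near: h; move: dgv => /cvgr_dist_le/(_ _ eps2); apply: filterS.
have hs : `|h *: v| < s by near: h; exact: near_line.
have hle : `|h| <= eps / 2 / ((`|C| + 1) * (`|v| ^+ 2 + 1)).
  by near: h; apply: dnbhs0_le; rewrite divr_gt0.
have := fg (h *: v + y); rewrite addrK => /(_ hs) H2.
have -> : 'D_v g y - h^-1 *: ((f \o shift y) (h *: v) - f y) =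
    ('D_v g y - h^-1 *: (g (h *: v + y) - g y))
    - h^-1 * (f (h *: v + y) - g (h *: v + y)).
  by rewrite /GRing.scale/= fgy; ring.
rewrite (le_trans (ler_normB _ _))// [eps in leRHS]splitr lerD//.
rewrite normrM normfV mulrC ler_pdivrMr ?normr_gt0//.
apply: (le_trans H2); rewrite normrZ exprMn.
rewrite ler_pdivlMr// in hle.
have k1 : C * `|v| ^+ 2 <= (`|C| + 1) * (`|v| ^+ 2 + 1).
  have a1 := ler_norm C; have a2 := sqr_ge0 `|v|.
  have a3 : C * `|v| ^+ 2 <= `|C| * `|v| ^+ 2 by rewrite ler_wpM2r.
  have a4 := normr_ge0 C; nra.
have k2 := ler_wpM2l (normr_ge0 h) k1.
have k3 := ler_wpM2l (normr_ge0 h) (le_trans k2 hle).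
apply: le_trans _ (le_trans k3 _); last by rewrite mulrC.
by rewrite le_eqVlt; apply/orP; left; apply/eqP; ring.
Unshelve. all: by end_near. Qed.

(** By [grad_strict] the gradient at [y] is as close to [G t] as the expansion error allows.
    Exchanging them costs [P%:R] times that error, hence the division of [eps] by [P%:R + 1]. *)
Lemma uniform_C1_grad {T : Type} (x0 : 'rV[R]_P) (D : set T)
    (F : T -> 'rV[R]_P -> R) : uniform_C1 x0 D (fun=> 1) F ->
  forall eps, 0 < eps -> \forall r \near 0^'+, forall t x y, D t ->
    `|x - x0| < r -> `|y - x0| < r -> differentiable (F t) y /\
    `|F t x - F t y - edot (grad (F t) y) (x - y)| <= eps * `|x - y|.
Proof.
move=> [G [_ /(nbhs_normP x0 _).1[r0 r00 dF] sF]] eps eps0.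
have P1 : 0 < P%:R + 1 :> R by rewrite ltr_wpDl.
have e0 : 0 < eps / (P%:R + 1) by rewrite divr_gt0.
near=> r => t x y Dt xr yr.
have rr0 : r <= r0 by near: r; exact: nbhs_right_le.
have S z z' : `|z - x0| < r -> `|z' - x0| < r ->
    `|F t z - F t z' - edot (G t) (z - z')| <= eps / (P%:R + 1) * `|z - z'|.
  move=> zr z'r; rewrite -[X in X * `|_|](mulr1 (eps / (P%:R + 1))).
  by apply: (near (sF _ e0) r) => //; near: r.
have dy : differentiable (F t) y.
  by apply: dF => //=; rewrite distrC (lt_le_trans yr).
split=> //.
have gG : `|grad (F t) y - G t| <= eps / (P%:R + 1).
  apply: (@grad_strict _ _ _ (r - `|y - x0|)) => //.
  - by rewrite subr_gt0.
  - exact: ltW.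
  move=> z zy; apply: S => //.
  have -> : z - x0 = (z - y) + (y - x0) by rewrite addrA subrK.
  by rewrite (le_lt_trans (ler_normD _ _))// -ltrBrDr.
have -> : F t x - F t y - edot (grad (F t) y) (x - y) =
    (F t x - F t y - edot (G t) (x - y)) - edot (grad (F t) y - G t) (x - y).
  by rewrite edotBl; ring.
apply: (le_trans (ler_normB _ _)).
have h1 := S _ _ xr yr.
have h2 := edot_norm (grad (F t) y - G t) (x - y).
have h3 : P%:R * `|grad (F t) y - G t| * `|x - y| <= P%:R * (eps / (P%:R + 1)) * `|x - y|.
  by rewrite ler_wpM2r// ler_wpM2l.
have -> : eps * `|x - y| = eps / (P%:R + 1) * `|x - y| + P%:R * (eps / (P%:R + 1)) * `|x - y|.
  by field; rewrite gt_eqF.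
lra.
Unshelve. all: by end_near. Qed.

End derivative_comparison.

(** * Uniform expansions of the models near a point of the parameter box *)

Section local_regularity.
Context {R : realType} {V : completeNormedModType R} {P : nat}.
Variables (pb : problem V P) (dec : decomposition V P) (x0 : 'rV[R]_P).
Hypothesis wp : well_posed pb.
Hypothesis sep : separable pb dec.
Hypothesis smooth : smooth_data pb dec.
Hypothesis x0_param : param_set pb x0.
Implicit Types (x y mu : 'rV[R]_P) (u v p : V) (S : rb_spaces V).

Let near_set (r : R) : set 'rV[R]_P := [set x | `|x - x0| < r].

(** The form [a_] at [x0] plays the role of the inner product in the frame expansion. This provides
    bounds for the components of the decomposition, which are merely bilinear. *)
Lemma form_bounded_Vh (b : V -> V -> R) : bilinear_form b ->
  exists C, forall u v, Vh pb u -> Vh pb v -> `|b u v| <= C * `|u| * `|v|.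
Proof.
move=> bb; have [Vfd /(_ _ x0_param)[[abd [c c0 ac] asym] _ _ _]] := wp.
apply: (finite_dim_form_bounded Vfd (bilinear_a pb x0)) => //.
exact: (definite_coercive c0 (@subset_refl _ _) (fun v _ => ac v)).
Qed.

Lemma functional_bounded_Vh (f : V -> R) : scalar f ->
  exists C, forall v, Vh pb v -> `|f v| <= C * `|v|.
Proof.
move=> fl; have [Vfd /(_ _ x0_param)[[abd [c c0 ac] asym] _ _ _]] := wp.
apply: (finite_dim_functional_bounded Vfd (bilinear_a pb x0)) => //.
exact: (definite_coercive c0 (@subset_refl _ _) (fun v _ => ac v)).
Qed.

Lemma biscalar_bilinear (b : {biscalar V}) : bilinear_form b.
Proof. by split=> v a u w; [rewrite linearPl|rewrite linearPr]. Qed.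

(** The arguments [(u, v)] index the family, weighted by the product of their norms, so that one
    radius and one constant serve all of them. *)
Lemma separable_form_lipschitz n (theta : 'I_n -> 'rV[R]_P -> R)
    (comp : 'I_n -> {biscalar V}) (b : 'rV[R]_P -> V -> V -> R) :
  (forall q, twice_differentiable (theta q) x0) ->
  (forall x u v, b x u v = \sum_q theta q x * comp q u v) ->
  exists K : R, 0 <= K /\
    \forall r \near 0^'+, lipschitz_forms (near_set r) (Vh pb) K b.
Proof.
move=> th bE.
pose D := [set t : V * V | Vh pb t.1 /\ Vh pb t.2].
pose w (t : V * V) := `|t.1| * `|t.2|.
have w0 t : 0 <= w t by rewrite mulr_ge0.
have : uniform_C1 x0 D w (fun t x => \sum_q theta q x * comp q t.1 t.2).
  apply: (uniform_C1_sum w0) => q.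
  have [C CP] := form_bounded_Vh (biscalar_bilinear (comp q)).
  apply: (uniform_C1_scale w0 (K := C)) => // t [t1 t2].
  by rewrite mulrA; exact: CP.
move=> /(uniform_C1_lipschitz w0)[K [K0 KP]]; exists K; split=> //.
apply: filterS KP => r KP x y u v Bx By Vu Vv.
by have := KP (u, v) x y (conj Vu Vv) Bx By; rewrite /w/= !bE.
Qed.

Lemma separable_functional_lipschitz n (theta : 'I_n -> 'rV[R]_P -> R)
    (comp : 'I_n -> {scalar V}) (f : 'rV[R]_P -> V -> R) :
  (forall q, twice_differentiable (theta q) x0) ->
  (forall x v, f x v = \sum_q theta q x * comp q v) ->
  exists K : R, 0 <= K /\
    \forall r \near 0^'+, lipschitz_functionals (near_set r) (Vh pb) K f.
Proof.
move=> th fE.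
have w0 (v : V) : 0 <= `|v| by [].
have : uniform_C1 x0 (Vh pb) (fun v => `|v|) (fun v x => \sum_q theta q x * comp q v).
  apply: (uniform_C1_sum w0) => q.
  have cl : scalar (comp q) by move=> a u v; rewrite linearP.
  have [C CP] := functional_bounded_Vh cl.
  exact: (uniform_C1_scale w0 (K := C)).
move=> /(uniform_C1_lipschitz w0)[K [K0 KP]]; exists K; split=> //.
apply: filterS KP => r KP x y v Bx By Vv.
by have := KP v x y Vv Bx By; rewrite !fE.
Qed.

Lemma lipschitz_forms_le B W (M M' : R) b : M <= M' ->
  lipschitz_forms (P := P) (V := V) B W M b -> lipschitz_forms B W M' b.
Proof.
move=> MM bM x y u v Bx By Wu Wv; have [h1 h2] := bM x y u v Bx By Wu Wv.
split; first by rewrite (le_trans h1)// ler_wpM2r// mulr_ge0.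
by rewrite (le_trans h2)// ler_wpM2r// ler_wpM2r// mulr_ge0.
Qed.

Lemma lipschitz_functionals_le B W (M M' : R) f : M <= M' ->
  lipschitz_functionals (P := P) (V := V) B W M f ->
  lipschitz_functionals B W M' f.
Proof.
move=> MM fM x y v Bx By Wv; have [h1 h2] := fM x y v Bx By Wv.
split; first by rewrite (le_trans h1)// ler_wpM2r.
by rewrite (le_trans h2)// ler_wpM2r// ler_wpM2r.
Qed.

(** Within a radius of at most [c / 2 / (Ka + 1)] the Lipschitz bound lets [a_] lose no more than
    half of its coercivity constant at [x0]. *)
Lemma regular_nearby : exists M c : R,
  \forall r \near 0^'+, regular_near pb (near_set r) M c.
Proof.
have [Vfd /(_ _ x0_param)[[_ [c c0 ac] _] _ _ _]] := wp.
have [_ _ _ [ta tl tj tk]] := smooth x0_param.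
have [sa sl sj sk] := sep.
have [Ka [Ka0 La]] := separable_form_lipschitz ta sa.
have [Kk [Kk0 Lk]] := separable_form_lipschitz tk sk.
have [Kl [Kl0 Ll]] := separable_functional_lipschitz tl sl.
have [Kj [Kj0 Lj]] := separable_functional_lipschitz tj sj.
exists (Ka + Kk + Kl + Kj), (c / 2).
have rc : 0 < c / 2 / (Ka + 1) by rewrite !divr_gt0// ltr_wpDl.
near=> r.
have La' : lipschitz_forms (near_set r) (Vh pb) Ka (fun x => a_ pb x) by near: r.
split=> //.
- by rewrite divr_gt0.
- by rewrite !addr_ge0.
- by apply: lipschitz_forms_le La'; lra.
- by apply: (@lipschitz_forms_le _ _ Kk); [lra|near: r].
- by apply: (@lipschitz_functionals_le _ _ Kl); [lra|near: r].
- by apply: (@lipschitz_functionals_le _ _ Kj); [lra|near: r].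
move=> x v Bx Vv.
have r0 : 0 < r by near: r; exact: nbhs_right_gt.
have B0 : near_set r x0 by rewrite /near_set/= subrr normr0.
have [_ h] := La' x x0 v v Bx B0 Vv Vv.
have rle : r <= c / 2 / (Ka + 1) by near: r; apply: nbhs_right_le.
have := ac v.
have h2 : Ka * (`|v| * `|v|) * `|x - x0| <= c / 2 * `|v| ^+ 2.
  have k1 : Ka * `|x - x0| <= c / 2.
    rewrite ler_pdivlMr ?ltr_wpDl// in rle.
    apply: le_trans rle; rewrite mulrC ler_pM//; first exact: ltW.
    by rewrite lerDl.
  by have := ler_wpM2r (sqr_ge0 `|v|) k1; rewrite expr2; lra.
by move: h; rewrite ler_norml => /andP[h _]; lra.
Unshelve. all: by end_near. Qed.

(** The index is a pair of a primal and a dual state. [L] will be the bound of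
    [rb_solution_lipschitz], so that the pairs of snapshots at all nearby [mu] belong to one
    family. *)
Lemma lagrangian_uniform_C1 (L : R) : 0 <= L -> uniform_C1 x0
  [set t : V * V | [/\ Vh pb t.1, Vh pb t.2, `|t.1| <= L & `|t.2| <= L]]
  (fun=> 1) (fun t => lagrangian pb t.1 t.2).
Proof.
move=> L0; set D := [set t | _].
have [_ _ tc [ta tl tj tk]] := smooth x0_param.
have [sa sl sj sk] := sep.
have w0 (t : V * V) : 0 <= (1 : R) by exact: ler01.
have functional n (theta : 'I_n -> 'rV[R]_P -> R) (comp : 'I_n -> {scalar V})
    (s : V * V -> V) :
    (forall q, twice_differentiable (theta q) x0) ->
    (forall t, D t -> Vh pb (s t) /\ `|s t| <= L) ->
    uniform_C1 x0 D (fun=> 1) (fun t x => \sum_q theta q x * comp q (s t)).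
  move=> th sD; apply: (uniform_C1_sum w0) => q.
  have cl : scalar (comp q) by move=> a u v; rewrite linearP.
  have [C CP] := functional_bounded_Vh cl.
  apply: (uniform_C1_scale w0 (K := `|C| * L)) => // t /sD[Vt tL].
  rewrite mulr1 (le_trans (CP _ Vt))//.
  apply: (@le_trans _ _ (`|C| * `|s t|)); last by rewrite ler_wpM2l.
  by rewrite ler_wpM2r// ler_norm.
have form n (theta : 'I_n -> 'rV[R]_P -> R) (comp : 'I_n -> {biscalar V})
    (s : V * V -> V) (e : R) :
    (forall q, twice_differentiable (theta q) x0) ->
    (forall t, D t -> Vh pb (s t) /\ `|s t| <= L) ->
    uniform_C1 x0 D (fun=> 1)
      (fun t x => \sum_q theta q x * (e * comp q t.1 (s t))).
  move=> th sD; apply: (uniform_C1_sum w0) => q.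
  have [C CP] := form_bounded_Vh (biscalar_bilinear (comp q)).
  apply: (uniform_C1_scale w0 (K := `|e| * (`|C| * L * L))) => // t Dt.
  have [Vt tL] := sD _ Dt; have [V1 _ t1L _] := Dt.
  rewrite mulr1 normrM ler_wpM2l// (le_trans (CP _ _ V1 Vt))//.
  apply: (@le_trans _ _ (`|C| * `|t.1| * `|s t|)).
    by rewrite ler_wpM2r// ler_wpM2r// ler_norm.
  by rewrite ler_pM// ?mulr_ge0// ler_wpM2l.
have D1 t : D t -> Vh pb t.1 /\ `|t.1| <= L by case.
have D2 t : D t -> Vh pb t.2 /\ `|t.2| <= L by case.
(* [Theta] is not part of the decomposition, but it is the cost of the state 0, whose smoothness
   Assumption 2 provides. *)
have cT : uniform_C1 x0 D (fun=> 1) (fun (t : V * V) x => cost pb 0 x * 1).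
  by apply: (uniform_C1_scale w0 (K := 1)) => // t _; rewrite normr1 mulr1.
have := uniform_C1_add cT (uniform_C1_add (functional _ _ (@comp_j _ _ _ dec) _ tj D1)
  (uniform_C1_add (form _ _ (@comp_k _ _ _ dec) _ 1 tk D1)
  (uniform_C1_add (functional _ _ (@comp_l _ _ _ dec) _ tl D2)
  (form _ _ (@comp_a _ _ _ dec) _ (-1) ta D2)))).
congr (uniform_C1 _ _ _ _); apply/funext => t; apply/funext => x.
rewrite /lagrangian /cost /res_pr linear0 linear0l !addr0 mulr1.
rewrite sj sk sl sa.
have -> : \sum_(q < Xi_k dec) theta_k q x * (1 * comp_k q t.1 t.1)
    = \sum_(q < Xi_k dec) theta_k q x * comp_k q t.1 t.1.
  by apply: eq_bigr => q _; rewrite mul1r.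
have -> : \sum_(q < Xi_a dec) theta_a q x * (-1 * comp_a q t.1 t.2)
    = - \sum_(q < Xi_a dec) theta_a q x * comp_a q t.1 t.2.
  by rewrite -sumrN; apply: eq_bigr => q _; rewrite mulN1r mulrN.
ring.
Qed.

Definition enriched_at mu S : Prop :=
  [/\ rb_in_Vh pb S, Vpr S (u_h pb mu) & Vdu S (p_h pb mu)].

Lemma enriched_exact M c r : regular_near pb (near_set r) M c ->
  forall mu S, near_set r mu -> enriched_at mu S ->
  [/\ u_r pb S mu = u_h pb mu, p_r pb S mu = p_h pb mu & exact_at pb S mu].
Proof.
move=> reg mu S Bmu [okS Su Sp].
have uE := u_r_snapshot reg okS Bmu Su.
have pE := p_r_snapshot reg okS Bmu Su Sp.
by split=> // v Vv; rewrite uE pE; exact: (exact_at_fom reg Bmu).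
Qed.

Lemma fom_enriched M c r : regular_near pb (near_set r) M c ->
  forall mu, near_set r mu -> enriched_at mu (fom_spaces pb).
Proof.
move=> reg mu Bmu; have ok := rb_in_Vh_fom reg.
by split=> //; [exact: (u_r_Vh reg ok Bmu)|exact: (p_r_Vh reg ok Bmu)].
Qed.

Lemma Jh_fom M c r : regular_near pb (near_set r) M c ->
  forall x, near_set r x -> Jr pb (fom_spaces pb) x = Jh pb x.
Proof.
move=> reg x Bx; rewrite /Jr.
have [ok _ Vp] := fom_enriched reg Bx.
by have [-> _] := exact_at_fom reg Bx Vp; rewrite addr0.
Qed.

Lemma Jr_enriched M c r : regular_near pb (near_set r) M c ->
  forall mu S, near_set r mu -> enriched_at mu S -> Jr pb S mu = Jh pb mu.
Proof.
move=> reg mu S Bmu en; rewrite /Jr /Jh.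
have [uE pE ex] := enriched_exact reg Bmu en.
have Vp : Vh pb (p_r pb S mu).
  by have [okS _ _] := en; exact: (p_r_Vh reg okS Bmu).
by have [-> _] := ex _ Vp; rewrite uE addr0.
Qed.

(** [Jr pb S] and the full order model both agree to second order at [mu] with the Lagrangian of the
    snapshots; they share its value and gradient, and its uniform expansion carries over. The base
    point [mu] must lie in the box, [x] need not. *)
Lemma model_strict eps : 0 < eps -> \forall r \near 0^'+, forall mu S x,
  param_set pb mu -> near_set r mu -> near_set r x -> enriched_at mu S ->
  [/\ Jr pb S mu = Jh pb mu, grad (Jr pb S) mu = grad (Jh pb) mu
    & `|Jr pb S x - Jr pb S mu - edot (grad (Jh pb) mu) (x - mu)|
        <= eps * `|x - mu|].
Proof.
move=> eps0; have [M [c regs]] := regular_nearby.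
have [r1 [r10 reg]] := filter_ex (filterI (nbhs_right_gt (0 : R)) regs).
have [C [C0 CP]] := Jr_second_order reg.
have [L [L0 LP]] := rb_solution_lipschitz reg.
have e2 : 0 < eps / 2 by rewrite divr_gt0.
(* With [|x - mu| <= 2 * r], this radius bounds [C * |x - mu| ^+ 2] by [eps / 2 * |x - mu|]. *)
have e3 : 0 < eps / 2 / (2 * C + 1) by rewrite divr_gt0// ltr_wpDl// mulr_ge0.
near=> r => mu S x Pmu Bmu Bx en.
have rr1 : r <= r1 by near: r; exact: nbhs_right_le.
have B1mu : near_set r1 mu by exact: lt_le_trans Bmu rr1.
have B1x : near_set r1 x by exact: lt_le_trans Bx rr1.
have ksym : Defs.symmetric_form (k_ pb mu).
  by have [_ /(_ _ Pmu)[_ _ _ []]] := wp.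
have second S' : enriched_at mu S' -> forall y, near_set r1 y ->
    `|Jr pb S' y - lagrangian pb (u_h pb mu) (p_h pb mu) y| <= C * `|y - mu| ^+ 2.
  move=> en' y By; have [uE pE ex] := enriched_exact reg B1mu en'.
  have [ok _ _] := en'.
  by have := CP S' y mu ok By B1mu ex ksym; rewrite uE pE.
have en0 := fom_enriched reg B1mu.
pose t := (u_h pb mu, p_h pb mu).
have [ok0 Vu Vp] := en0.
have Dt : [/\ Vh pb t.1, Vh pb t.2, `|t.1| <= L & `|t.2| <= L].
  have [b1 b2 _ _] := LP _ mu mu ok0 B1mu B1mu.
  by split.
have C1 z : near_set r z -> differentiable (lagrangian pb t.1 t.2) mu /\
    `|lagrangian pb t.1 t.2 z - lagrangian pb t.1 t.2 mu
      - edot (grad (lagrangian pb t.1 t.2) mu) (z - mu)| <= eps / 2 * `|z - mu|.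
  move=> Bz.
  exact: (near (uniform_C1_grad (lagrangian_uniform_C1 L0) e2) r _ t z mu Dt Bz Bmu).
have s0 : 0 < r1 - `|mu - x0| by rewrite subr_gt0.
have inball y : `|y - mu| < r1 - `|mu - x0| -> near_set r1 y.
  move=> ymu; rewrite /near_set/=.
  have -> : y - x0 = (y - mu) + (mu - x0) by rewrite addrA subrK.
  by rewrite (le_lt_trans (ler_normD _ _))// -ltrBrDr.
have [dL _] := C1 _ Bmu.
have gL : grad (Jh pb) mu = grad (lagrangian pb t.1 t.2) mu.
  apply: (grad_second_order s0 dL (C := C)) => y /inball By.
  by rewrite -(Jh_fom reg By); exact: second.
have gS : grad (Jr pb S) mu = grad (lagrangian pb t.1 t.2) mu.
  by apply: (grad_second_order s0 dL (C := C)) => y /inball By; exact: second.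
split; [exact: (Jr_enriched reg B1mu en)|by rewrite gS|].
rewrite gL.
have [_ h1] := C1 x Bx.
have h2 := second S en x B1x; have h3 := second S en mu B1mu.
rewrite subrr normr0 expr0n mulr0 normr_le0 subr_eq0 in h3.
rewrite (eqP h3).
rewrite -/t.1 -/t.2 in h2 *.
have -> : Jr pb S x - lagrangian pb (u_h pb mu) (p_h pb mu) mu
    - edot (grad (lagrangian pb t.1 t.2) mu) (x - mu) =
  (Jr pb S x - lagrangian pb t.1 t.2 x)
  + (lagrangian pb t.1 t.2 x - lagrangian pb t.1 t.2 mu
      - edot (grad (lagrangian pb t.1 t.2) mu) (x - mu)).
  by rewrite /t/=; ring.
rewrite (le_trans (ler_normD _ _))// [eps]splitr mulrDl lerD//.
apply: (le_trans h2); rewrite expr2 mulrA ler_wpM2r//.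
have xmu : `|x - mu| <= 2 * r.
  have -> : x - mu = (x - x0) - (mu - x0) by rewrite opprB addrA subrK.
  by rewrite (le_trans (ler_normB _ _))// mulr2n mulrDl !mul1r lerD// ltW.
have rle : r <= eps / 2 / (2 * C + 1) by near: r; apply: nbhs_right_le.
rewrite ler_pdivlMr ?ltr_wpDl ?mulr_ge0// in rle.
have r0 : 0 < r by near: r; exact: nbhs_right_gt.
have := ler_wpM2l C0 xmu.
lra.
Unshelve. all: by end_near. Qed.

(* Expanding Jh at mu and at x0 along a step in the i-th direction whose length
   is comparable to the distance of mu and x0 compares the two gradients. *)
Lemma grad_Jh_continuous eps : 0 < eps -> \forall r \near 0^'+, forall mu,
  param_set pb mu -> near_set r mu ->
  `|grad (Jh pb) mu - grad (Jh pb) x0| <= eps.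
Proof.
move=> eps0; have [M [c regs]] := regular_nearby.
(* Three expansions over distances of at most [r], [2 * r] and [r] are combined, so their errors add
   up to [eps * r]. *)
have e4 : 0 < eps / 4 by rewrite divr_gt0.
have [r1 [r10 [reg H]]] :=
  filter_ex (filterI (nbhs_right_gt (0 : R)) (filterI regs (model_strict e4))).
have r2 : 0 < r1 / 2 by rewrite divr_gt0.
near=> r => mu Pmu Bmu.
have rle : r <= r1 / 2 by near: r; exact: nbhs_right_le.
have r0 : 0 < r by near: r; exact: nbhs_right_gt.
have B1mu : near_set r1 mu by apply: lt_le_trans Bmu _; lra.
have B1x0 : near_set r1 x0 by rewrite /near_set/= subrr normr0.
apply: norm_le_coord => [|i]; first exact: ltW.
pose x := mu + r *: delta_mx 0 i.
have xmu : x - mu = r *: delta_mx 0 i by rewrite /x addrAC subrr add0r.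
have nxmu : `|x - mu| <= r.
  rewrite xmu normrZ gtr0_norm// ler_piMr ?(ltW r0)//.
  by apply: norm_le_coord => // j; rewrite mxE/= ger0_norm// lern1 leq_b1.
have xx0 : x - x0 = (x - mu) + (mu - x0) by rewrite addrA subrK.
have nxx0 : `|x - x0| <= 2 * r.
  by rewrite xx0 (le_trans (ler_normD _ _))// mulr2n mulrDl !mul1r lerD// ltW.
have B1x : near_set r1 x.
  rewrite /near_set/= xx0 (le_lt_trans (ler_normD _ _))//.
  by have : `|mu - x0| < r by []; lra.
have [_ _] := H mu (fom_spaces pb) x Pmu B1mu B1x (fom_enriched reg B1mu).
have [_ _] := H x0 (fom_spaces pb) x x0_param B1x0 B1x (fom_enriched reg B1x0).
have [_ _] := H x0 (fom_spaces pb) mu x0_param B1x0 B1mu (fom_enriched reg B1x0).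
set Jx := Jr _ _ x; set Jm := Jr _ _ mu; set J0 := Jr _ _ x0.
rewrite !ler_norml; 
set g := grad (Jh pb) mu; set g0 := grad (Jh pb) x0.
have -> : edot g (x - mu) = r * g 0 i by rewrite xmu edotZr edot_delta.
have -> : edot g0 (x - x0) = r * g0 0 i + edot g0 (mu - x0).
  by rewrite xx0 edotDr xmu edotZr edot_delta.
have b1 : eps / 4 * `|x - mu| <= eps / 4 * r by rewrite ler_wpM2l// ltW.
have b2 : eps / 4 * `|x - x0| <= eps / 4 * (2 * r) by rewrite ler_wpM2l// ltW.
have b3 : eps / 4 * `|mu - x0| <= eps / 4 * r.
  by rewrite ler_wpM2l ?(ltW e4)// ltW.
move=> /andP[h1 h2] /andP[h3 h4] /andP[h5 h6].
have -> : (g - g0) 0 i = g 0 i - g0 0 i by rewrite !mxE.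
rewrite -(ler_pM2l r0) -(ler_pM2l r0 _ eps).
by apply/andP; split; lra.
Unshelve. all: by end_near. Qed.

End local_regularity.

(** * The projected line search *)

Section projection.
Context {R : realType} {P : nat}.
Implicit Types (x y g lo up : 'rV[R]_P).

Let clip1 (lo up y : R) := Num.max lo (Num.min y up).

Let clip1_cases (lo up y : R) : lo <= up ->
  [\/ [/\ y <= lo & clip1 lo up y = lo], [/\ lo <= y, y <= up & clip1 lo up y = y]
    | [/\ up <= y & clip1 lo up y = up]].
Proof.
move=> lu; rewrite /clip1; have [yu|uy] := leP y up.
  have [ly|yl] := leP lo y; first by apply: Or32.
  by apply: Or31; split=> //; exact: ltW.
by rewrite (max_idPr lu); apply: Or33; split=> //; exact: ltW.
Qed.

Lemma clip_box lo up x y : box lo up x -> box lo up (clip lo up y).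
Proof.
move=> xb i; have /andP[l u] := xb i; have lu := le_trans l u.
rewrite mxE -/(clip1 _ _ _).
by have [[_ ->]|[? ? ->]|[_ ->]] := clip1_cases (y 0 i) lu; apply/andP; split.
Qed.

Lemma clip_lipschitz lo up x y z i : box lo up x ->
  `|clip lo up y 0 i - clip lo up z 0 i| <= `|y 0 i - z 0 i|.
Proof.
move=> xb; have /andP[l u] := xb i; have lu := le_trans l u.
rewrite !mxE -!/(clip1 _ _ _).
have := ler_norm (y 0 i - z 0 i); have := ler_norm (z 0 i - y 0 i).
rewrite (distrC (z 0 i)) => h1 h2; rewrite ler_norml.
have := normr_ge0 (y 0 i - z 0 i).
by have [[? ->]|[? ? ->]|[? ->]] := clip1_cases (y 0 i) lu;
  have [[? ->]|[? ? ->]|[? ->]] := clip1_cases (z 0 i) lu => ?;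
  apply/andP; split; lra.
Qed.

(** Nonexpansiveness of the projection; it carries a nonzero residual coordinate from an
    accumulation point to nearby iterates. *)
Lemma clip_residual_lipschitz lo up x y g h i : box lo up x ->
  `|(x - clip lo up (x - g)) 0 i|
    <= `|(y - clip lo up (y - h)) 0 i| + 2 * `|x - y| + `|g - h|.
Proof.
move=> xb.
have subE (u v : 'rV[R]_P) : (u - v) 0 i = u 0 i - v 0 i by rewrite !mxE.
have c1 := clip_lipschitz (x - g) (y - h) i xb.
have c2 := ler_coord_norm (x - y) i; have c3 := ler_coord_norm (g - h) i.
rewrite !subE in c1 c2 c3 *.
have c4 : `|x 0 i - g 0 i - (y 0 i - h 0 i)| <= `|x - y| + `|g - h|.
  have -> : x 0 i - g 0 i - (y 0 i - h 0 i) =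
    (x 0 i - y 0 i) - (g 0 i - h 0 i) by ring.
  by rewrite (le_trans (ler_normB _ _))// lerD.
have {1}-> : x 0 i - clip lo up (x - g) 0 i
    = (y 0 i - clip lo up (y - h) 0 i) + ((x 0 i - y 0 i)
      - (clip lo up (x - g) 0 i - clip lo up (y - h) 0 i)) by ring.
rewrite (le_trans (ler_normD _ _))// -[leRHS]addrA lerD2l (le_trans (ler_normB _ _))//.
by rewrite mulr2n mulrDl mul1r -[leRHS]addrA lerD// (le_trans c1).
Qed.

Lemma clip_id lo up x : box lo up x -> clip lo up x = x.
Proof.
move=> xb; apply/rowP => i; have /andP[l u] := xb i.
by rewrite mxE (min_idPl u) (max_idPr l).
Qed.

(** The variational inequality of the projection onto an interval, tested with the point [x 0 i] of
    that interval. *)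
Lemma clip_obtuse lo up x g t i : box lo up x -> 0 < t ->
  let s := clip lo up (x - t *: g) 0 i - x 0 i in t * (g 0 i * s) <= - s ^+ 2.
Proof.
move=> xb t0; have /andP[l u] := xb i; have lu := le_trans l u.
rewrite !mxE -!/(clip1 _ _ _) /=.
by have [[? ->]|[? ? ->]|[? ->]] := clip1_cases (x 0 i - t * g 0 i) lu; nra.
Qed.

(** The length of the projected step is the minimum of [t * |g 0 i|] and the distance to a bound: a
    concave function of [t] that vanishes at 0, hence at least [t] times its value at 1. *)
Lemma clip_step_ge lo up x g t i : box lo up x -> 0 <= t <= 1 ->
  t * `|(x - clip lo up (x - g)) 0 i|
    <= `|clip lo up (x - t *: g) 0 i - x 0 i|.
Proof.
move=> xb /andP[t0 t1]; have /andP[l u] := xb i; have lu := le_trans l u.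
rewrite !mxE -!/(clip1 _ _ _) distrC -{1}(ger0_norm t0) -normrM.
set a := x 0 i in l u *; set b := g 0 i.
have t1' : 0 <= 1 - t by rewrite subr_ge0.
have [b0|/ltW b0] := leP 0 b.
  have tb : 0 <= t * b by rewrite mulr_ge0.
  have tb1 : 0 <= (1 - t) * b by rewrite mulr_ge0.
  by have [[? ->]|[? ? ->]|[? ->]] := clip1_cases (a - b) lu;
    have [[? ->]|[? ? ->]|[? ->]] := clip1_cases (a - t * b) lu;
    rewrite !ler0_norm; nra.
have tb : t * b <= 0 by rewrite mulr_ge0_le0.
have tb1 : (1 - t) * b <= 0 by rewrite mulr_ge0_le0.
by have [[? ->]|[? ? ->]|[? ->]] := clip1_cases (a - b) lu;
  have [[? ->]|[? ? ->]|[? ->]] := clip1_cases (a - t * b) lu;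
  rewrite !ger0_norm; nra.
Qed.

Lemma norm2_sqr x : norm2 x ^+ 2 = \sum_i x 0 i ^+ 2.
Proof. by rewrite sqr_sqrtr// sumr_ge0// => i _; rewrite sqr_ge0. Qed.

Lemma norm2_ge0 x : 0 <= norm2 x.
Proof. exact: sqrtr_ge0. Qed.

Lemma coord_le_norm2 x i : `|x 0 i| <= norm2 x.
Proof.
rewrite -sqrtr_sqr ler_sqrt; last by rewrite sumr_ge0// => j _; rewrite sqr_ge0.
by rewrite (bigD1 i)//= lerDl sumr_ge0// => j _; rewrite sqr_ge0.
Qed.

Lemma norm_le_norm2 x : `|x| <= norm2 x.
Proof. by apply: norm_le_coord => [|i]; rewrite ?norm2_ge0 ?coord_le_norm2. Qed.

Lemma norm2_gt0_coord x : 0 < norm2 x -> exists i, x 0 i != 0.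
Proof.
move=> x0; apply: contrapT => /forallNP h; move: x0.
rewrite /norm2 big1 ?sqrtr0 ?ltxx// => i _.
by have /negP := h i; rewrite negbK => /eqP ->; rewrite expr0n.
Qed.

End projection.

(** * Decrease at the AGC point near a non-critical parameter *)

Section local_decrease.
Context {R : realType} {V : completeNormedModType R} {P : nat}.
Variables (pb : problem V P) (dec : decomposition V P) (x0 : 'rV[R]_P).
Hypothesis wp : well_posed pb.
Hypothesis sep : separable pb dec.
Hypothesis smooth : smooth_data pb dec.
Hypothesis x0_param : param_set pb x0.
Hypothesis pos : positive_cost pb.
Implicit Types (x mu : 'rV[R]_P) (S : rb_spaces V).

Let near_set (r : R) : set 'rV[R]_P := [set x | `|x - x0| < r].

(** The estimator is of second order, while the model stays above half of the positive value
    [Jh pb x0]. The latter is deduced from expansions, as [Jr] carries a residual correction and [x]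
    may lie outside the box. *)
Lemma rel_error_small (eps : R) : 0 < eps -> \forall r \near 0^'+,
  forall mu S x, param_set pb mu -> near_set r mu -> near_set r x ->
  enriched_at pb mu S -> rel_error pb S x <= eps.
Proof.
move=> eps0; have [M [c regs]] := regular_nearby wp sep smooth x0_param.
have [r1 [r10 [reg [ms gc]]]] :=
  filter_ex (filterI (nbhs_right_gt (0 : R)) (filterI regs
    (filterI (model_strict wp sep smooth x0_param (@ltr01 R))
      (grad_Jh_continuous wp sep smooth x0_param (@ltr01 R))))).
have [C [C0 CP]] := Delta_J_second_order reg.
pose J0 := Jh pb x0; have J00 : 0 < J0 by exact: pos.
(* A Lipschitz constant near [x0]: gradients exceed the one at [x0] by at most 1, and the expansions
   have error factor 1. *)
pose K : R := P%:R * (`|grad (Jh pb) x0| + 1) + 1.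
have K0 : 0 < K by rewrite ltr_wpDl// mulr_ge0// addr_ge0.
near=> r => mu S x Pmu Bmu Bx en.
have r0 : 0 < r by near: r; exact: nbhs_right_gt.
have rr1 : r <= r1 by near: r; exact: nbhs_right_le.
have B1mu : near_set r1 mu by exact: lt_le_trans Bmu rr1.
have B1x : near_set r1 x by exact: lt_le_trans Bx rr1.
have B1x0 : near_set r1 x0 by rewrite /near_set/= subrr normr0.
have slope (g v : 'rV[R]_P) : `|g| <= `|grad (Jh pb) x0| + 1 ->
    `|edot g v| + 1 * `|v| <= K * `|v|.
  move=> gb; rewrite /K [leRHS]mulrDl lerD2r (le_trans (edot_norm _ _))//.
  by rewrite ler_wpM2r// ler_wpM2l.
have gmu : `|grad (Jh pb) mu| <= `|grad (Jh pb) x0| + 1.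
  have := gc mu Pmu B1mu; have := ler_normD (grad (Jh pb) mu - grad (Jh pb) x0) (grad (Jh pb) x0).
  by rewrite subrK; lra.
have g0b : `|grad (Jh pb) x0| <= `|grad (Jh pb) x0| + 1 by rewrite lerDl.
have en0 := fom_enriched reg B1x0.
have [j0E _] := ms x0 _ mu x0_param B1x0 B1mu en0.
rewrite j0E (Jh_fom reg B1mu) => h0.
have [jE _ h1] := ms mu S x Pmu B1mu B1x en.
have s0 := slope _ (mu - x0) g0b; have s1 := slope _ (x - mu) gmu.
have xmu : `|x - mu| <= 2 * r.
  have -> : x - mu = (x - x0) - (mu - x0) by rewrite opprB addrA subrK.
  by rewrite (le_trans (ler_normB _ _))// mulr2n mulrDl !mul1r lerD// ltW.
have k1 : K * `|x - mu| <= K * (2 * r) by rewrite ler_pM2l.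
have k2 : K * `|mu - x0| <= K * r by rewrite ler_pM2l// ltW.
(* The expansions from [x0] to [mu] and from [mu] to [x] lose at most [K * r + K * (2 * r)], which
   has to stay below [J0 / 2]. *)
have rK : r * (6 * K) <= J0.
  rewrite -ler_pdivlMr ?mulr_gt0//; near: r; apply: nbhs_right_le.
  by rewrite divr_gt0// mulr_gt0.
have Jx : J0 / 2 <= Jr pb S x.
  move: h0 h1; rewrite jE -/J0 !ler_norml => /andP[h0 _] /andP[h1 _].
  have := ler_norm (- edot (grad (Jh pb) mu) (x - mu)).
  have := ler_norm (- edot (grad (Jh pb) x0) (mu - x0)).
  rewrite !normrN; lra.
have Jx0 : 0 < Jr pb S x by apply: lt_le_trans Jx; rewrite divr_gt0.
rewrite /rel_error ler_pdivrMr//.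
have [_ _ ex] := enriched_exact reg B1mu en.
have [okS _ _] := en.
apply: (le_trans (CP S x mu okS B1x B1mu ex)).
have rC : r * (8 * (C + 1)) <= eps * J0.
  rewrite -ler_pdivlMr ?mulr_gt0 ?ltr_wpDl//; near: r; apply: nbhs_right_le.
  by rewrite !(divr_gt0, mulr_gt0)// ltr_wpDl.
have r1' : r <= 1 by near: r; exact: nbhs_right_le.
have q1 : `|x - mu| ^+ 2 <= 4 * r.
  have : `|x - mu| ^+ 2 <= (2 * r) ^+ 2 by rewrite !expr2 ler_pM.
  by move=> /le_trans; apply; nra.
have q2 := ler_wpM2l C0 q1.
have q3 : eps * (J0 / 2) <= eps * Jr pb S x by rewrite ler_pM2l.
lra.
Unshelve. all: by end_near. Qed.

(** A nonzero residual coordinate at [x0] keeps at least half of its size at nearby iterates, so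
    step size [t] moves the iterate by at least [t * chi / 2]. The slope along the projected step is
    at most minus the squared step length over [t], which dominates the expansion error, and
    [rel_error_small] makes the trust-region constraint hold. Every step size up to [t0] is
    therefore admissible, and backtracking cannot pass below [kappa * t0]. *)
Lemma agc_decrease (kappa kappa_arm tau : R) (i : 'I_P) :
  0 < kappa < 1 -> 0 < kappa_arm < 2^-1 -> 0 < tau ->
  (x0 - clip (mu_a pb) (mu_b pb) (x0 - grad (Jh pb) x0)) 0 i != 0 ->
  exists2 sigma : R, 0 < sigma & \forall r \near 0^'+,
  forall mu S delta agc, param_set pb mu -> near_set r mu ->
  enriched_at pb mu S -> tau < delta ->
  line_search (mu_a pb) (mu_b pb) (Jr pb S) (rel_error pb S) kappa kappa_arm
    delta mu (- grad (Jr pb S) mu) agc ->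
  Jr pb S agc <= Jr pb S mu - sigma.
Proof.
have half_le (e a b d r : R) : 0 < e -> e <= a + 2 * b + d -> b < r -> r <= e / 16 ->
    d <= e / 8 -> e / 2 <= a by lra.
have lt_add_half (a b c d : R) : a <= c / 2 -> d <= c / 2 -> b < d ->
    a + b < c by lra.
(* For step length [N], slope [E] and expansion error [e * b]: the assumption [4 * t * e <= N]
   leaves three quarters of the decrease [N ^+ 2 / t], more than the fraction [k < 1/2] asked
   for. *)
have armijo (t e N E a b k : R) : 0 < t -> 0 <= N -> 0 <= e -> k < 2^-1 ->
    a <= E + e * b -> b <= N -> t * E <= - N ^+ 2 -> t * (8 * e / 2) <= N ->
    a <= - (k / t) * N ^+ 2.
  move=> t0 N0 e0 k2 aE bN tE tN; rewrite -(ler_pM2l t0).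
  have -> : t * (- (k / t) * N ^+ 2) = - (k * N ^+ 2) by field; rewrite gt_eqF.
  have w1 := ler_wpM2r N0 tN; have w2 := ler_wpM2r (sqr_ge0 N) (ltW k2).
  have w3 := ler_wpM2l (ltW t0) (le_trans aE (lerD (lexx _) (ler_wpM2l e0 bN))).
  have w4 := sqr_ge0 N; rewrite expr2 in tE w2 w4 *; lra.
move=> /andP[k0 k1] /andP[ka0 ka1] tau0 crit.
set lo := mu_a pb in crit *; set up := mu_b pb in crit *.
have subE (x y : 'rV[R]_P) l : (x - y) 0 l = x 0 l - y 0 l by rewrite !mxE.
pose chi : R := `|(x0 - clip lo up (x0 - grad (Jh pb) x0)) 0 i|.
have chi0 : 0 < chi by rewrite normr_gt0.
have chiE : `|(x0 - clip lo up (x0 - grad (Jh pb) x0)) 0 i| = chi by [].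
clearbody chi.
have e0 : 0 < chi / 8 by rewrite divr_gt0.
have [r1 [r10 [ms [gc re]]]] :=
  filter_ex (filterI (nbhs_right_gt (0 : R))
    (filterI (model_strict wp sep smooth x0_param e0)
    (filterI (grad_Jh_continuous wp sep smooth x0_param e0)
      (rel_error_small tau0)))).
pose Gm := `|grad (Jh pb) x0| + chi / 8.
have Gm0 : 0 < Gm by rewrite ltr_wpDl.
(* Steps of size at most [t0] move by at most [r1 / 2], so that trial points from the ball of radius
   [r1 / 2] stay in that of radius [r1]. *)
pose t0 := Num.min 1 (r1 / 2 / Gm).
have t00 : 0 < t0 by rewrite lt_min ltr01 !divr_gt0.
have t01 : t0 <= 1 by rewrite ge_min lexx.
have t0G : t0 * Gm <= r1 / 2 by rewrite -ler_pdivlMr// ge_min lexx orbT.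
(* The Armijo decrease [kappa_arm / t * (t * chi / 2) ^+ 2] at the smallest possible step size
   [t = kappa * t0]. *)
exists (kappa_arm * (kappa * t0) * (chi / 2) ^+ 2).
  by rewrite !(mulr_gt0, exprn_gt0, divr_gt0).
near=> r => mu S delta agc Pmu Bmu en taud [j [[arm _] first ->]].
have r0 : 0 < r by near: r; exact: nbhs_right_gt.
have rr1 : r <= r1 / 2 by near: r; apply: nbhs_right_le; rewrite divr_gt0.
have rchi : r <= chi / 16 by near: r; apply: nbhs_right_le; rewrite divr_gt0.
have B1mu : near_set r1 mu.
  have c4 : `|mu - x0| < r by [].
  rewrite /near_set/= -[mu - x0]add0r (le_lt_trans (ler_normD _ _))//.
  by rewrite (lt_add_half _ _ _ r)// normr0 divr_ge0// ltW.
have [_ gE _] := ms mu S mu Pmu B1mu B1mu en.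
move: arm first; rewrite gE; set g := grad (Jh pb) mu.
pose trial k := clip lo up (mu + kappa ^+ k *: - g).
have trialE k : trial k = clip lo up (mu - kappa ^+ k *: g).
  by rewrite /trial scalerN.
have gg0 : `|g - grad (Jh pb) x0| <= chi / 8 by exact: gc.
have gG : `|g| <= Gm.
  by rewrite -[g](subrK (grad (Jh pb) x0)) (le_trans (ler_normD _ _))// addrC lerD2l.
have critmu : chi / 2 <= `|(mu - clip lo up (mu - g)) 0 i|.
  have c4 : `|x0 - mu| < r by rewrite distrC.
  have c5 : `|grad (Jh pb) x0 - g| <= chi / 8 by rewrite distrC.
  have h : chi <= `|(mu - clip lo up (mu - g)) 0 i| + 2 * `|x0 - mu|
      + `|grad (Jh pb) x0 - g|.
    by rewrite -chiE; exact: clip_residual_lipschitz.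
  exact: half_le chi0 h c4 rchi c5.
have step k : kappa ^+ k * (chi / 2) <= norm2 (trial k - mu).
  have kk : 0 <= kappa ^+ k <= 1 by rewrite exprn_ge0 ?exprn_ile1// ltW.
  have := clip_step_ge g i Pmu kk; rewrite -/lo -/up -trialE => h.
  apply: le_trans (coord_le_norm2 (trial k - mu) i).
  rewrite subE.
  apply: le_trans h; rewrite ler_wpM2l//.
  by case/andP: kk.
have adm k : kappa ^+ k <= t0 ->
    Jr pb S (trial k) - Jr pb S mu
      <= - (kappa_arm / kappa ^+ k) * norm2 (trial k - mu) ^+ 2 /\
    rel_error pb S (trial k) <= delta.
  move=> kt0; set t := kappa ^+ k in kt0 *.
  have tp : 0 < t by rewrite exprn_gt0.
  have N0 := norm2_ge0 (trial k - mu).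
  have sG : `|trial k - mu| <= r1 / 2.
    apply: le_trans t0G; apply: norm_le_coord => [|l].
      by rewrite mulr_ge0 ?ltW.
    have := clip_lipschitz (mu - t *: g) mu l Pmu.
    rewrite -/lo -/up (clip_id Pmu) -trialE.
    rewrite [(trial k - mu) 0 l]subE.
    move=> /le_trans; apply.
    have -> : (mu - t *: g) 0 l - mu 0 l = - (t * g 0 l) by rewrite !mxE; ring.
    rewrite normrN normrM (gtr0_norm tp) ler_pM// ?(ltW tp)//.
    exact: le_trans (ler_coord_norm _ _) gG.
  have Bt : near_set r1 (trial k).
    have c4 : `|mu - x0| < r by [].
    rewrite /near_set/=.
    have -> : trial k - x0 = (trial k - mu) + (mu - x0) by rewrite addrA subrK.
      by rewrite (le_lt_trans (ler_normD _ _))// (lt_add_half _ _ _ r).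
  split; last by rewrite (le_trans (re mu S (trial k) Pmu B1mu Bt en))// ltW.
  have [_ _] := ms mu S (trial k) Pmu B1mu Bt en.
  rewrite -/g ler_norml => /andP[_]; rewrite lerBlDl => h.
  have gs : t * edot g (trial k - mu) <= - norm2 (trial k - mu) ^+ 2.
    rewrite norm2_sqr /edot mulr_sumr -sumrN; apply: ler_sum => l _.
    rewrite subE.
    by rewrite trialE; exact: clip_obtuse.
  have sN := norm_le_norm2 (trial k - mu).
  apply: (armijo _ (chi / 8) _ (edot g (trial k - mu)) _ `|trial k - mu|) => //.
  - exact: ltW.
  - have -> : 8 * (chi / 8) = chi by field.
    exact: step.
move=> arm first.
(* For [j = 0] the step size is 1; otherwise the preceding exponent was rejected, so its step size
   exceeds [t0]. *)
have kj : kappa * t0 <= kappa ^+ j.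
  case: j first {arm} => [_|j first].
    rewrite expr0; apply: (le_trans (ler_wpM2l (ltW k0) t01)).
    by rewrite mulr1 ltW.
  rewrite exprS ler_pM2l// ltW// ltNge; apply/negP => /adm.
  exact: first.
have kp : 0 < kappa ^+ j by rewrite exprn_gt0.
rewrite -/lo -/up -/(trial j) in arm *.
rewrite -lerBlDl; apply: le_trans arm _; rewrite mulNr lerN2.
have w1 : (kappa ^+ j * (chi / 2)) ^+ 2 <= norm2 (trial j - mu) ^+ 2.
  by rewrite !expr2 ler_pM// mulr_ge0// ltW// divr_gt0.
have w2 : 0 <= kappa_arm / kappa ^+ j by rewrite divr_ge0 ?ltW.
apply: le_trans (ler_wpM2l w2 w1).
have -> : kappa_arm / kappa ^+ j * (kappa ^+ j * (chi / 2)) ^+ 2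
  = kappa_arm * kappa ^+ j * (chi / 2) ^+ 2 by field; rewrite gt_eqF.
by rewrite ler_wpM2r ?sqr_ge0// ler_pM2l.
Unshelve. all: by end_near. Qed.

End local_decrease.

(** * Invariants of the algorithm *)

Section algorithm_invariants.
Context {R : realType} {V : completeNormedModType R} {P : nat}.
Variables (pb : problem V P) (dec : decomposition V P) (par : tr_parameters R P).
Hypothesis wp : well_posed pb.
Hypothesis sep : separable pb dec.
Hypothesis smooth : smooth_data pb dec.
Implicit Types (mu : 'rV[R]_P) (S : rb_spaces V) (s : tr_state V P).

Lemma snapshots_in_Vh mu : param_set pb mu ->
  Vh pb (u_h pb mu) /\ Vh pb (p_h pb mu).
Proof.
move=> Pmu; have [M [c regs]] := regular_nearby wp sep smooth Pmu.
have [r [r0 reg]] := filter_ex (filterI (nbhs_right_gt (0 : R)) regs).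
have Bmu : `|mu - mu| < r by rewrite subrr normr0.
by have [] := fom_enriched reg Bmu.
Qed.

Lemma rb_init_enriched mu : param_set pb mu ->
  enriched_at pb mu (rb_init pb mu).
Proof.
move=> Pmu; have [Vu Vp] := snapshots_in_Vh Pmu.
have Vfd := wp.1.
have lineV (v : V) : Vh pb v -> line_of v `<=` Vh pb.
  move=> Vv _ [c _ <-]; rewrite -[c *: v]addr0.
  exact: (finite_dim_subspaceP _ Vfd Vv (finite_dim_subspace0 Vfd)).
have line_mem (v : V) : line_of v v by exists 1; rewrite ?scale1r.
split; [|exact: line_mem|exact: line_mem].
by split; [exact: finite_dim_line|exact: lineV|exact: finite_dim_line|exact: lineV].
Qed.

Lemma rb_update_enriched S mu S' : param_set pb mu -> rb_in_Vh pb S ->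
  rb_update pb S mu S' -> enriched_at pb mu S'.
Proof.
move=> Pmu okS; have [Vu Vp] := snapshots_in_Vh Pmu.
have [fpr spr fdu sdu] := okS; have Vfd := wp.1.
case=> [->|].
  split=> /=; last 2 first.
  - exact: (add_snapshot_mem _ (finite_dim_subspace0 fpr)).
  - exact: (add_snapshot_mem _ (finite_dim_subspace0 fdu)).
  by split=> /=; try exact: finite_dim_add_snapshot; exact: (add_snapshot_sub Vfd).
set W1 := add_snapshot _ (u_h pb mu); set W := add_snapshot _ _ => ->.
have f1 : finite_dim_subspace W1 by exact: finite_dim_add_snapshot.
have f2 : finite_dim_subspace W by exact: finite_dim_add_snapshot.
have WV : W `<=` Vh pb.
  exact: (add_snapshot_sub Vfd (add_snapshot_sub Vfd spr Vu) Vp).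
split=> //=; last exact: (add_snapshot_mem _ (finite_dim_subspace0 f1)).
apply: sub_add_snapshot.
exact: (add_snapshot_mem _ (finite_dim_subspace0 fpr)).
Qed.

Lemma tr_solve_param S mu delta agc mu' : param_set pb mu ->
  tr_solve pb par S mu delta agc mu' -> param_set pb mu'.
Proof.
move=> Pmu [m [L [[eps [H [_ _ m0 ls _]]] _ ->]]].
suff : forall l, (l <= L)%N -> param_set pb (m l) by apply.
elim=> [|l IHl] lL; first by rewrite m0.
have lm : (l < maxn L 1)%N by rewrite leq_max lL.
have [j [_ _ ->]] := ls l lm.
by apply: clip_box; exact: (IHl (ltnW lL)).
Qed.

Lemma tr_solve_agc S mu delta agc mu' : tr_solve pb par S mu delta agc mu' ->
  line_search (mu_a pb) (mu_b pb) (Jr pb S) (rel_error pb S)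
    (kappa par) (kappa_arm par) delta mu (- grad (Jr pb S) mu) agc.
Proof.
move=> [m [L [[eps [H [_ _ m0 ls _]]] -> _]]].
have lm : (0 < maxn L 1)%N by rewrite leq_max orbT.
by have := ls 0%N lm; rewrite /= m0.
Qed.

Definition enriched_state s : Prop :=
  param_set pb (st_mu s) /\ enriched_at pb (st_mu s) (st_rb s).

(** A rejection keeps both the iterate and the spaces, and an acceptance adds the snapshots of the
    new iterate; from the old spaces only finite dimension and inclusion in [Vh] are carried
    over. *)
Lemma tr_step_enriched s s' : tr_step pb par s s' ->
  enriched_state s -> enriched_state s'.
Proof.
elim=> {s s'} [mu delta S agc mu' S' sol _ up [/= Pmu [okS _ _]]|
    mu delta S agc mu' s _ _ _ _ IH /IH//|
    mu delta S agc mu' S' sol _ _ up _ [/= Pmu [okS _ _]]|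
    mu delta S agc mu' S' s _ _ _ _ _ _ IH /IH//].
- have Pmu' := tr_solve_param Pmu sol.
  by split=> //=; exact: rb_update_enriched up.
- have Pmu' := tr_solve_param Pmu sol.
  by split=> //=; exact: rb_update_enriched up.
Qed.

End algorithm_invariants.

(** * Accumulation points and the contradiction with positivity of the cost *)

Lemma cluster_sequence_frequently {R : realType} {P : nat}
    (x : nat -> 'rV[R]_P) (l : 'rV[R]_P) :
  cluster (x @ \oo) l -> forall N (r : R), 0 < r ->
  exists2 k, (N <= k)%N & `|x k - l| < r.
Proof.
move=> cl N r r0.
have tail : (x @ \oo) (x @` [set k | (N <= k)%N]).
  by exists N => // k /= Nk; exists k.
have ball_l : nbhs l [set y | `|y - l| < r].
  apply: (nbhs_normP l [set y | `|y - l| < r]).2.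
  by exists r => // y /=; rewrite distrC.
by have [_ [[k Nk <-] kr]] := cl _ _ tail ball_l; exists k.
Qed.

Lemma cluster_box {R : realType} {P : nat} (lo up : 'rV[R]_P)
    (x : nat -> 'rV[R]_P) (l : 'rV[R]_P) :
  (forall k, box lo up (x k)) -> cluster (x @ \oo) l -> box lo up l.
Proof.
move=> xb cl i; apply/andP; split; apply/ler_addgt0Pr => e e0;
  have [k _ kr] := cluster_sequence_frequently cl 0 e0;
  have := le_lt_trans (ler_coord_norm (x k - l) i) kr;
  rewrite !mxE ltr_norml => /andP[h1 h2]; have /andP[h3 h4] := xb k i; lra.
Qed.

Theorem theorem3p3 (R : realType) (V : completeNormedModType R)
  (ip : {dot V for idfun}) (P : nat) (pb : problem V P)
  (dec : decomposition V P) (eps_h : R) (par : tr_parameters R P)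
  (foc_test : bool) (st : nat -> tr_state V P) (mubar : 'rV[R]_P)
  (V_hilbert : inner_product ip)
  (pb_well_posed : well_posed pb)
  (par_admissible : admissible_parameters pb par)
  (assumption1 : separable pb dec)
  (assumption2 : smooth_data pb dec)
  (assumption3 : truth pb eps_h)
  (assumption4 : positive_cost pb)
  (st_generated : tr_rb_sequence pb par foc_test st)
  (assumption5 : sufficient_decrease pb par st)
  (mubar_accumulation : cluster ((fun k => st_mu (st k)) @ \oo) mubar) :
  norm2 (mubar - clip (mu_a pb) (mu_b pb) (mubar - grad (Jh pb) mubar))
    <= tau_sub par.
Proof.
have [[Pinit _] [kap kaparm] _ _ [ts0 _]] := par_admissible.
have [st0 steps] := st_generated.
have inv k : enriched_state pb (st k).
  elim: k => [|k IHk].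
    rewrite st0; split=> //.
    exact: (rb_init_enriched pb_well_posed assumption1 assumption2).
  have [step _] := steps k.
  exact: (tr_step_enriched pb_well_posed assumption1 assumption2 step).
have Pbar : param_set pb mubar.
  by apply: cluster_box mubar_accumulation => k; have [] := inv k.
(* By [Jr_enriched] this is [Jh] at the iterate, hence positive; in terms of [Jr], Assumption 5
   links consecutive values directly. *)
pose F k := Jr pb (st_rb (st k)) (st_mu (st k)).
have F_gt0 k : 0 < F k.
  have [Pk en] := inv k.
  have [M [c regs]] := regular_nearby pb_well_posed assumption1 assumption2 Pk.
  have [r [r0 reg]] := filter_ex (filterI (nbhs_right_gt (0 : R)) regs).
  have Bk : `|st_mu (st k) - st_mu (st k)| < r by rewrite subrr normr0.
  by rewrite /F (Jr_enriched reg Bk en); exact: assumption4.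
(* [delta] and [agc] are those of Assumption 5, which may differ from those of the accepted outer
   step. *)
have descent k : exists delta agc, [/\ @tau_mac R < delta,
    line_search (mu_a pb) (mu_b pb) (Jr pb (st_rb (st k)))
      (rel_error pb (st_rb (st k))) (kappa par) (kappa_arm par) delta
      (st_mu (st k)) (- grad (Jr pb (st_rb (st k))) (st_mu (st k))) agc
    & F k.+1 <= Jr pb (st_rb (st k)) agc].
  have [delta [agc [tau_lt /tr_solve_agc ls Fagc]]] := assumption5 k.
  by exists delta, agc.
have F_noninc k : F k.+1 <= F k.
  have [delta [agc [_ [j [[arm _] _ agcE]] Fagc]]] := descent k.
  rewrite (le_trans Fagc)// agcE -subr_le0 (le_trans arm)//.
  have /andP[k0 _] := kap; have /andP[ka0 _] := kaparm.
  by rewrite mulNr oppr_le0 mulr_ge0 ?sqr_ge0// divr_ge0// ltW// exprn_gt0.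
(* As [tau_sub] is nonnegative, a violated bound yields a nonzero coordinate of the residual. *)
rewrite leNgt; apply/negP => /(le_lt_trans ts0) /norm2_gt0_coord[i crit].
have tau0 : 0 < @tau_mac R by rewrite divr_gt0// exprn_gt0.
have [sigma sigma0 near_dec] := agc_decrease pb_well_posed assumption1
  assumption2 Pbar assumption4 kap kaparm tau0 crit.
have [r [r0 dec_r]] := filter_ex (filterI (nbhs_right_gt (0 : R)) near_dec).
have F_mono N k : (N <= k)%N -> F k <= F N.
  move=> /subnK <-; elim: (k - N)%N => [//|n IHn].
  by rewrite addSn (le_trans (F_noninc _)).
(* Every visit to the ball around [mubar] lowers [F] by [sigma]; monotonicity preserves the gain
   until the next visit. *)
have drop n : exists k, F k <= F 0%N - sigma *+ n.
  elim: n => [|n [N FN]]; first by exists 0%N; rewrite mulr0n subr0.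
  have [k Nk kr] := cluster_sequence_frequently mubar_accumulation N r0.
  have [Pk en] := inv k.
  have [delta [agc [tau_lt ls Fagc]]] := descent k.
  exists k.+1; rewrite (le_trans Fagc)//.
  have := dec_r _ _ _ _ Pk kr en tau_lt ls; rewrite -/(F k) => h.
  have := F_mono _ _ Nk; rewrite mulrS; lra.
(* More than [F 0 / sigma] drops would make [F] negative. *)
have [k Fk] := drop (Num.truncn (F 0%N / sigma)).+1.
have := truncnS_gt (F 0%N / sigma); rewrite ltr_pdivrMr// mulr_natl => h.
have := F_gt0 k; lra.
Qed.
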